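(* Let $(E_n)_{n\in\mathbb{N}}$ be a betting sequence with drift certificate $(c_n)$, fix $t\in\mathbb{N}$ and $\alpha\in(0,1)$, and let $C_t\in\mathbb{R}$ be a constant with $\sum_{n\le t}c_n\ge C_t$ $\mathbb{P}_1$-a.s. Assume there are constants $a\in(0,\infty)$, $p\in(1,2]$ and $K_n,M_{p,n}\in[0,\infty)$ such that, $\mathbb{P}_1$-a.s. for every $n\in\mathbb{N}$, $$\mathbb{P}_1(L_n\le c_n-x\mid\mathcal{F}_{n-1})\le K_ne^{-ax}\ \text{ for all }x\ge0,\qquad \mathbb{E}_{\mathbb{P}_1}\big[((L_n-c_n)_+)^p\mid\mathcal{F}_{n-1}\big]\le M_{p,n}.$$ Let $K\ge\sum_{n\le t}K_n$ and $M_p\ge\sum_{n\le t}M_{p,n}$ be constants, and $c_p:=\sup_{v>0}\frac{e^{-v}-1+v}{v^p}$. Then $c_p\le2^{1-p}$, $c_2=\frac12$, and, with $s_{\max}=a$: 1. $\psi_n(s):=c_pM_{p,n}s^p+\frac{K_ns^2}{a(a-s)}$ is a majorant on $[0,a)$, and $\Psi^{(t)}(s)=c_pM_ps^p+\frac{Ks^2}{a(a-s)}$ satisfies $\sum_{n\le t}\psi_n\le\Psi^{(t)}$ (so $(C_t,\Psi^{(t)})$ is an aggregate at horizon $t$). 2. With $s_{\ast}:=\min\Big\{\big(\frac{\Delta_t}{4c_pM_p}\big)^{\frac1{p-1}},\ \frac{a^2\Delta_t}{8K},\ \frac a2\Big\}$, $$\bar\gamma_t(\alpha)\le\gamma_t(\alpha)\le\exp\Big(-\sup_{0\le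 s<a}\Big\{s\Delta_t-c_pM_ps^p-\frac{Ks^2}{a(a-s)}\Big\}\Big)\le\exp\big(-\tfrac12s_{\ast}\Delta_t\big).$$ 3. If $K>0$ and $\Delta_t>0$, the supremum is attained at the unique $s_t^{\ast}\in(0,a)$ solving $$p\,c_pM_p\,s^{p-1}+\frac{Ks(2a-s)}{a(a-s)^2}=\Delta_t .$$ 4. If $\Delta_t>0$, then $$\frac{\sup_{0\le s<a}\{s\Delta_t-\Psi^{(t)}(s)\}}{\frac12s_{\ast}\Delta_t}\le\max\Big\{4,\ \frac{2(p-1)}{p}\Big(\frac4p\Big)^{\frac1{p-1}}\Big\};$$ moreover this ratio is at most $2$ if $p=2$ and the first entry in the definition of $s_{\ast}$ is the smallest, and at most $4$ if the second or third entry is the smallest.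
   Context: Conventions: $\log$ is natural, $\log0=-\infty$; $(x)_+=\max\{x,0\}$; in the definition of $s_{\ast}$ an entry with zero denominator is read as $+\infty$. Setting: $(\Omega,\mathcal{F})$ is a measurable space with a filtration $(\mathcal{F}_t)_{t\in\mathbb{N}_0}$, $\mathcal{F}_0=\{\emptyset,\Omega\}$, and $\mathbb{P}_0,\mathbb{P}_1$ are probability measures with $\mathbb{P}_1|_{\mathcal{F}_t}\ll\mathbb{P}_0|_{\mathcal{F}_t}$ for all $t$. A betting sequence is a family of $\mathcal{F}_n$-measurable maps $E_n:\Omega\to[0,\infty]$ with $\mathbb{E}_{\mathbb{P}_0}[E_n\mid\mathcal{F}_{n-1}]\le1$ $\mathbb{P}_0$-a.s. Wealth: $W_0=1$, $W_t=\prod_{n\le t}E_n$; $L_n:=\log E_n$. For $\alpha\in(0,1)$: $\ell:=\log\frac1\alpha$, $\tau_\alpha:=\inf\{t\in\mathbb{N}:W_t>\frac1\alpha\}$, $\gamma_t(\alpha):=\mathbb{P}_1(W_t\le\frac1\alpha)$, $\bar\gamma_t(\alpha):=\mathbb{P}_1(\tau_\alpha>t)$; $\Delta_t:=(C_t-\ell)_+$. Drift certificate: real random variables $c_n$, $\mathcal{F}_{n-1}$-measurable, with $\mathbb{E}_{\mathbb{P}_1}[L_n\mid\mathcal{F}_{n-1}]\ge c_n$ $\mathbb{P}_1$-a.s. (conditional expectation in the extended sense, required to be well defined). Put $\varphi_n(s):=\log\mathbb{E}_{\mathbb{P}_1}[e^{-s(L_n-c_n)}\mid\mathcal{F}_{n-1}]$.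 Majorant on $[0,s_{\max})$: maps $\psi_n:[0,s_{\max})\times\Omega\to[0,\infty]$ with $\psi_n(s)$ $\mathcal{F}_{n-1}$-measurable, $\psi_n(0)=0$, and $\varphi_n(s)\le\psi_n(s)$ $\mathbb{P}_1$-a.s. for all $n$, $s$. Aggregate at horizon $t$: deterministic $C_t$, $\Psi^{(t)}$ with $\sum_{n\le t}c_n\ge C_t$ and $\sum_{n\le t}\psi_n(s)\le\Psi^{(t)}(s)$ $\mathbb{P}_1$-a.s. for all $s\in[0,s_{\max})$. *)

(* Defs.v *)
From HB Require Import structures.
From mathcomp Require Import all_boot all_order all_algebra.
From mathcomp Require Import all_classical all_reals all_analysis.
From mathcomp Require Import measurable_realfun.

Set Implicit Arguments.
Unset Strict Implicit.
Unset Printing Implicit Defensive.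

Import Order.TTheory GRing.Theory Num.Theory.
Import numFieldNormedType.Exports.

Local Open Scope classical_set_scope.
Local Open Scope ring_scope.

(* Random sequences indexed by the positive integers are functions on [nat]
   whose value at 0 is never used; [F n.-1] is the sigma-algebra of the past. *)

Section conditional_expectation.
Context {d : measure_display} {T : measurableType d} {R : realType}.
Local Open Scope ereal_scope.

(* For a sigma-algebra [G] on [T], the measurable sets of
   [g_sigma_algebraType G] are exactly the members of [G]. *)
Definition sub_measurable {d' : measure_display} {U : sigmaRingType d'}
    (G : set (set T)) (f : T -> U) : Prop :=
  measurable_fun [set: g_sigma_algebraType G] (f : g_sigma_algebraType G -> U).

Definition condexp_ge0_version (P : probability T R) (G : set (set T))
    (X Y : T -> \bar R) : Prop :=
  [/\ sub_measurable G Y,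
      forall w, 0 <= Y w
    & forall A, G A -> \int[P]_(w in A) Y w = \int[P]_(w in A) X w].

(* A choice of version; for measurable [X >= 0] a [0, +oo]-valued version
   exists (Radon-Nikodym) and is unique up to P-null sets. *)
Definition condexp_ge0 (P : probability T R) (G : set (set T))
    (X : T -> \bar R) : T -> \bar R :=
  xget (cst 0) [set Y | condexp_ge0_version P G X Y].

(* Extended sense: E[X | G] = E[X^+ | G] - E[X^- | G], meaningful as soon as
   the two terms are almost surely not both infinite. *)
Definition condexp (P : probability T R) (G : set (set T))
    (X : T -> \bar R) : T -> \bar R :=
  fun w => condexp_ge0 P G X^\+ w - condexp_ge0 P G X^\- w.

Definition condexp_well_defined (P : probability T R) (G : set (set T))
    (X : T -> \bar R) : Prop :=
  {ae P, forall w,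
     condexp_ge0 P G X^\+ w < +oo \/ condexp_ge0 P G X^\- w < +oo}.

Definition condprob (P : probability T R) (G : set (set T)) (A : set T) :
    T -> \bar R :=
  condexp P G (fun w => (\1_A w)%:E).

End conditional_expectation.

Section betting.
Context {d : measure_display} {T : measurableType d} {R : realType}.
Local Open Scope ereal_scope.

Definition filtration (F : nat -> set (set T)) : Prop :=
  [/\ forall n, sigma_algebra setT (F n),
      forall n, F n `<=` measurable,
      forall m n, (m <= n)%N -> F m `<=` F n
    & F 0%N = [set set0; setT]].

Definition locally_abs_continuous (F : nat -> set (set T))
    (P1 P0 : probability T R) : Prop :=
  forall n A, F n A -> P0 A = 0 -> P1 A = 0.

Definition betting_sequence (F : nat -> set (set T)) (P0 : probability T R)
    (E : nat -> T -> \bar R) : Prop :=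
  forall n, (0 < n)%N ->
    [/\ sub_measurable (F n) (E n),
        forall w, 0 <= E n w
      & {ae P0, forall w, condexp P0 (F n.-1) (E n) w <= 1}].

Definition wealth (E : nat -> T -> \bar R) (t : nat) (w : T) : \bar R :=
  \prod_(1 <= n < t.+1) E n w.

Definition log_bet (E : nat -> T -> \bar R) (n : nat) (w : T) : \bar R :=
  lne (E n w).

(* Equal to +oo when the threshold is never crossed. *)
Definition crossing_time (E : nat -> T -> \bar R) (alpha : R) (w : T) : \bar R :=
  ereal_inf [set n%:R%:E | n in
    [set n | (0 < n)%N /\ (alpha^-1)%:E < wealth E n w]].

Definition type2_error (P1 : probability T R) (E : nat -> T -> \bar R)
    (alpha : R) (t : nat) : \bar R :=
  P1 [set w | wealth E t w <= (alpha^-1)%:E].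

Definition running_type2_error (P1 : probability T R) (E : nat -> T -> \bar R)
    (alpha : R) (t : nat) : \bar R :=
  P1 [set w | t%:R%:E < crossing_time E alpha w].

Definition drift_certificate (F : nat -> set (set T)) (P1 : probability T R)
    (E : nat -> T -> \bar R) (c : nat -> T -> R) : Prop :=
  forall n, (0 < n)%N ->
    [/\ sub_measurable (F n.-1) (c n),
        condexp_well_defined P1 (F n.-1) (log_bet E n)
      & {ae P1, forall w,
           (c n w)%:E <= condexp P1 (F n.-1) (log_bet E n) w}].

Definition cumulant (F : nat -> set (set T)) (P1 : probability T R)
    (E : nat -> T -> \bar R) (c : nat -> T -> R) (n : nat) (s : R) (w : T) :
    \bar R :=
  lne (condexp P1 (F n.-1)
    (fun w' => expeR (- (s%:E * (log_bet E n w' - (c n w')%:E)))) w).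

(* Conditional expectations being defined up to null sets, the exceptional
   null set may depend on [n] and [s]. *)
Definition majorant (F : nat -> set (set T)) (P1 : probability T R)
    (E : nat -> T -> \bar R) (c : nat -> T -> R) (smax : R)
    (psi : nat -> R -> T -> \bar R) : Prop :=
  forall n, (0 < n)%N ->
    (forall w, psi n 0%R w = 0) /\
    forall s, (0 <= s < smax)%R ->
      [/\ sub_measurable (F n.-1) (psi n s),
          forall w, 0 <= psi n s w
        & {ae P1, forall w, cumulant F P1 E c n s w <= psi n s w}].

Definition aggregate (P1 : probability T R) (c : nat -> T -> R) (smax : R)
    (psi : nat -> R -> T -> \bar R) (t : nat) (C : R) (Psi : R -> \bar R) :
    Prop :=
  {ae P1, forall w, (C <= \sum_(1 <= n < t.+1) c n w)%R} /\
  forall s, (0 <= s < smax)%R ->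
    {ae P1, forall w, \sum_(1 <= n < t.+1) psi n s w <= Psi s}.

End betting.

Section rates.
Context {R : realType}.

Definition log_margin (alpha C : R) : R := Num.max (C - ln alpha^-1) 0.

Definition cp_set (p : R) : set R :=
  [set (expR (- v) - 1 + v) / v `^ p | v in [set v : R | 0 < v]].

Definition cp (p : R) : R := sup (cp_set p).

Definition mixed_bound (a p m k s : R) : R :=
  cp p * m * s `^ p + k * s ^+ 2 / (a * (a - s)).

(* The set is nonempty and, when [0 < a] and [m, k, Delta >= 0], bounded above
   by [a * Delta], so that [sup] is a genuine supremum. *)
Definition rate (a p m k Delta : R) : R :=
  sup [set s * Delta - mixed_bound a p m k s | s in [set s | 0 <= s < a]].

Definition div_or_pinfty (x y : R) : \bar R :=
  if y == 0 then +oo%E else (x / y)%:E.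

Definition s_entry1 (p m Delta : R) : \bar R :=
  poweR (div_or_pinfty Delta (4 * cp p * m)) (1 / (p - 1)).

Definition s_entry2 (a k Delta : R) : \bar R :=
  div_or_pinfty (a ^+ 2 * Delta) (8 * k).

Definition s_entry3 (a : R) : \bar R := (a / 2)%:E.

(* The third entry is finite and all entries are nonnegative, hence the minimum
   is a real number. *)
Definition s_star (a p m k Delta : R) : R :=
  fine (mine (s_entry1 p m Delta) (mine (s_entry2 a k Delta) (s_entry3 a))).

End rates.

(* Main.v *)
Require Import Defs.
From HB Require Import structures.
From mathcomp Require Import all_boot all_order all_algebra.
From mathcomp Require Import all_classical all_reals all_analysis.
From mathcomp Require Import measurable_realfun.
From mathcomp Require Import ring lra.

Set Implicit Arguments.
Unset Strict Implicit.
Unset Printing Implicit Defensive.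

Import Order.TTheory GRing.Theory Num.Theory.
Import numFieldNormedType.Exports.

Local Open Scope classical_set_scope.
Local Open Scope ring_scope.

(* For [x = L_n - c_n] and [g x = e^(s x) - 1 - s x] one has pointwise
     [e^(-s x) + s x^+ <= 1 + s x^- + c_p s^p (x^+)^p + g x^-].
   Integrate over an event [B] of the past on which [c_n] is bounded.  The drift
   certificate gives [int_B x^- <= int_B x^+], so the two linear terms cancel;
   the moment hypothesis controls the third term, and slicing [g x^-] into
   layers of width [h] and using the tail hypothesis on each gives, as [h -> 0],
   [K_n s^2 / (a (a - s)) P(B)].  Hence [E[e^(-s x) | past] <= 1 + psi_n s], and
   the type II bound is the Chernoff bound for the product of these factors.
   The maximiser of the rate is the zero of its derivative, and the comparison
   with [s_* Delta / 2] drops all but one of the terms of the rate, according to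
   which entry of the minimum is the smallest. *)

(** * Exponential remainders and the constant c_p *)

(** A conditional expectation is here a version picked by a choice operator, so the estimates are
    made on integrals over events of the past and only the outcome is turned back into a conditional
    bound. The obstacle is extended arithmetic: [L_n] may be infinite, and neither [L_n] nor [c_n]
    need be integrable. Hence almost sure finiteness of [L_n] and integrability of [x^-] are drawn
    from the tail and moment hypotheses, balances of positive and negative parts are written with
    sums only, and a term is cancelled only once its integral is known to be finite; boundedness of
    [c_n] on [B] serves exactly this. The two linear terms stay on opposite sides of the pointwise
    inequality because their integrals are ordered, not their values. The constant
    [s^2 / (a (a - s))] is the integral of [g'(x) e^(-a x)] over [x >= 0], namely
    [s / (a - s) - s / a]. *)

Section exponential_remainder.
Context {R : realType}.
Implicit Types v x p : R.

Lemma ge0_of_derive_ge0 (f f' : R -> R) :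
  (forall x, is_derive x 1 f (f' x)) -> f 0 = 0 ->
  (forall x, 0 <= x -> 0 <= f' x) -> forall x, 0 <= x -> 0 <= f x.
Proof.
move=> df f0 f'0 x x0; rewrite -f0.
apply: (@ger0_derive1_ndecr _ f 0 x) => // [y|].
- by rewrite in_itv/= derive1E derive_val => /andP[/ltW/f'0].
- apply: continuous_subspaceT => y.
  exact/differentiable_continuous/derivable1_diffP/ex_derive.
Qed.

Lemma expRN_ge1B v : 0 <= expR (- v) - 1 + v.
Proof. by have := expR_ge1Dx (- v); lra. Qed.

Lemma expRN_le_quad v : 0 <= v -> expR (- v) <= 1 - v + v ^+ 2 / 2.
Proof.
move=> v0; rewrite -subr_ge0; move: v v0.
apply: (@ge0_of_derive_ge0 (fun v => 1 - v + v ^+ 2 / 2 - expR (- v))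
  (fun v => expR (- v) - 1 + v)) => // [x||x _].
- apply: is_derive_eq; rewrite /GRing.scale/=; lra.
- by rewrite oppr0 expR0; lra.
- exact: expRN_ge1B.
Qed.

(** Serves the lower bound on [c_2]: the quotient defining it is at least [1/2 - v/6]. *)
Lemma expRN_ge_cubic v : 0 <= v ->
  1 - v + v ^+ 2 / 2 - v ^+ 3 / 6 <= expR (- v).
Proof.
move=> v0; rewrite -subr_ge0; move: v v0.
apply: (@ge0_of_derive_ge0
  (fun v => expR (- v) - (1 - v + v ^+ 2 / 2 - v ^+ 3 / 6))
  (fun v => 1 - v + v ^+ 2 / 2 - expR (- v))) => // [x||x x0].
- apply: is_derive_eq; rewrite /GRing.scale/=; lra.
- by rewrite oppr0 expR0; lra.
- by rewrite subr_ge0; exact: expRN_le_quad.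
Qed.

(** The numerator is at most [v^2 / 2] and at most [v]; these cross at [v = 2]. Divided by [v^p],
    the first is nondecreasing and the second decreasing, and both equal [2^(1 - p)] at the
    crossing. *)
Lemma cp_set_ubound p : 1 < p <= 2 -> ubound (cp_set p) (2 `^ (1 - p)).
Proof.
move=> /andP[p1 p2] _ [v /= v0 <-].
rewrite ler_pdivrMr ?powR_gt0//.
have [v2|v2] := leP v 2.
- apply: (@le_trans _ _ (v ^+ 2 / 2)).
    by have := expRN_le_quad (ltW v0); lra.
  have -> : v ^+ 2 = v `^ (2 - p) * v `^ p.
    by rewrite -powRD ?subrK ?powR_mulrn ?(ltW v0)// gt_eqF ?implybT.
  rewrite mulrAC ler_wpM2r ?powR_ge0//.
  have -> : 1 - p = (2 - p) - 1 by ring.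
  rewrite [2 `^ _]powRB; last by rewrite pnatr_eq0 implybT.
  rewrite powRr1// ler_pM2r ?invr_gt0//.
  by apply: ge0_ler_powR; rewrite ?nnegrE ?subr_ge0// ltW.
- apply: (@le_trans _ _ v).
    have : expR (- v) <= 1 by rewrite expR_le1; lra.
    lra.
  have {1}-> : v = v `^ (1 - p) * v `^ p :> R.
    by rewrite -powRD ?subrK ?powRr1 ?(ltW v0)// gt_eqF ?implybT.
  rewrite ler_wpM2r ?powR_ge0//.
  have -> : 1 - p = - (p - 1) by ring.
  rewrite !powRN lef_pV2 ?posrE ?powR_gt0//.
  by apply: ge0_ler_powR; rewrite ?nnegrE ?subr_ge0// ltW.
Qed.

Lemma has_sup_cp_set p : 1 < p <= 2 -> has_sup (cp_set p).
Proof.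
move=> hp; split; last by exists (2 `^ (1 - p)); exact: cp_set_ubound.
by exists ((expR (- 1) - 1 + 1) / 1 `^ p); exists 1 => //=; exact: ltr01.
Qed.

Lemma cp_le p : 1 < p <= 2 -> cp p <= 2 `^ (1 - p).
Proof.
move=> hp; apply: ge_sup; first by case: (has_sup_cp_set hp).
exact: cp_set_ubound.
Qed.

Lemma cp_ge p v : 1 < p <= 2 -> 0 < v ->
  (expR (- v) - 1 + v) / v `^ p <= cp p.
Proof.
move=> hp v0; apply: ub_le_sup; first by case: (has_sup_cp_set hp).
by exists v.
Qed.

Lemma cp_gt0 p : 1 < p <= 2 -> 0 < cp p.
Proof.
move=> hp; apply: lt_le_trans (cp_ge hp ltr01).
by rewrite powR1 divr1 subrK expR_gt0.
Qed.

Lemma expRN_le_cp p v : 1 < p <= 2 -> 0 <= v ->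
  expR (- v) + v <= 1 + cp p * v `^ p.
Proof.
move=> hp; rewrite le_eqVlt => /predU1P[<-|v0].
  rewrite oppr0 expR0 powR0 ?mulr0//; move: hp; lra.
have := cp_ge hp v0.
rewrite ler_pdivrMr ?powR_gt0//; lra.
Qed.

Lemma cp2 : cp (2 : R) = 2^-1.
Proof.
have h2 : 1 < (2 : R) <= 2 by lra.
apply/eqP; rewrite eq_le; apply/andP; split.
  apply: (le_trans (cp_le h2)).
  have -> : (1 - 2 : R) = -1 by ring.
  by rewrite powR_inv1.
apply/ler_addgt0Pr => e e0.
(* At [v = 6 e] the cubic lower bound loses exactly [v / 6 = e]. *)
have e6 : 0 < 6 * e by lra.
have := cp_ge h2 e6.
rewrite powR_mulrn ?(ltW e6)//.
move=> H; rewrite -lerBlDr; apply: (le_trans _ H); rewrite ler_pdivlMr ?exprn_gt0//.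
have := expRN_ge_cubic (ltW e6).
rewrite !exprS !expr0; nra.
Qed.

End exponential_remainder.

(** * The rate function *)

Section rate_bounds.
Context {R : realType}.
Implicit Types a p m k s D : R.

(** This is the tangent line of [s^p] at [u], rearranged. It follows from Young's inequality for [s]
    and [u^(p - 1)] with the conjugate exponents [p] and [p / (p - 1)]. *)
Lemma powR_tangent p s u : 1 < p -> 0 <= s -> 0 <= u ->
  p * s * u `^ (p - 1) <= s `^ p + (p - 1) * u `^ p.
Proof.
move=> p1 s0 u0.
have p0 : 0 < p by lra.
have q0 : 0 < p - 1 by lra.
have := @conjugate_powR _ s (u `^ (p - 1)) p (p / (p - 1)) s0 (powR_ge0 _ _) p0.
rewrite divr_gt0// => /(_ isT).
have -> : p^-1 + (p / (p - 1))^-1 = 1 by field; lra.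
rewrite -powRrM.
have -> : (p - 1) * (p / (p - 1)) = p by field; lra.
move=> /(_ erefl) H.
have : p * (s * u `^ (p - 1)) <= p * (s `^ p / p + u `^ p / (p / (p - 1))).
  by rewrite ler_pM2l.
have -> : p * (s `^ p / p + u `^ p / (p / (p - 1))) = s `^ p + (p - 1) * u `^ p.
  by field; lra.
by rewrite mulrA.
Qed.

Lemma mixed_bound0 a p m k : 1 < p -> mixed_bound a p m k 0 = 0.
Proof.
move=> p1; rewrite /mixed_bound powR0 ?expr0n/=; last by rewrite gt_eqF//; lra.
by rewrite !mulr0 mul0r addr0.
Qed.

Lemma mixed_bound_ge0 a p m k s : 0 < a -> 1 < p <= 2 -> 0 <= m -> 0 <= k ->
  s < a -> 0 <= mixed_bound a p m k s.
Proof.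
move=> a0 hp m0 k0 sa; rewrite /mixed_bound addr_ge0//.
  by rewrite !mulr_ge0 ?powR_ge0// ltW// cp_gt0.
by apply: divr_ge0; apply: mulr_ge0; rewrite ?sqr_ge0 ?subr_ge0// ltW.
Qed.

Lemma le_mixed_bound a p m k m' k' s : 0 < a -> 1 < p <= 2 -> s < a ->
  m <= m' -> k <= k' -> mixed_bound a p m k s <= mixed_bound a p m' k' s.
Proof.
move=> a0 hp sa mm kk; rewrite /mixed_bound lerD//.
  by rewrite ler_wpM2r ?powR_ge0// ler_wpM2l// ltW// cp_gt0.
rewrite ler_wpM2r ?invr_ge0 ?mulr_ge0 ?subr_ge0 ?(ltW a0) ?(ltW sa)//.
by rewrite ler_wpM2r// sqr_ge0.
Qed.

Lemma sum_mixed_bound a p (m k : nat -> R) s (t : nat) :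
  \sum_(1 <= n < t.+1) mixed_bound a p (m n) (k n) s =
  mixed_bound a p (\sum_(1 <= n < t.+1) m n) (\sum_(1 <= n < t.+1) k n) s.
Proof.
by rewrite /mixed_bound big_split/= -!mulr_suml -mulr_sumr.
Qed.

Section rate.
Variables a p m k D : R.
Hypotheses (a0 : 0 < a) (hp : 1 < p <= 2) (m0 : 0 <= m) (k0 : 0 <= k)
  (D0 : 0 <= D).

Let p1 : 1 < p. Proof. by case/andP: hp. Qed.

Lemma rate_le B : (forall s, 0 <= s < a -> s * D - mixed_bound a p m k s <= B) ->
  rate a p m k D <= B.
Proof.
move=> H; apply: ge_sup => [|_ [s /= sa <-]]; last exact: H.
by exists (0 * D - mixed_bound a p m k 0); exists 0 => //=; rewrite lexx.
Qed.

Lemma rate_ge s : 0 <= s < a -> s * D - mixed_bound a p m k s <= rate a p m k D.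
Proof.
move=> sa; apply: ub_le_sup; last by exists s.
exists (a * D) => _ [u /= /andP[u0 ua] <-].
rewrite lerBlDr (le_trans (ler_wpM2r D0 (ltW ua)))// lerDl.
exact: mixed_bound_ge0.
Qed.

(** Being below an entry of the minimum gives the corresponding inequality. An entry is [+oo] only
    when [m] or [k] is 0, and then the left side of its inequality vanishes. *)
Lemma s_starP : [/\ 0 <= s_star a p m k D, s_star a p m k D <= a / 2,
  k * s_star a p m k D <= a ^+ 2 * D / 8
  & cp p * m * s_star a p m k D `^ (p - 1) <= D / 4].
Proof.
have [a0' p1' m0' k0' D0'] := And5 a0 p1 m0 k0 D0.
have hc := cp_gt0 hp.
have e2 : s_entry2 a k D = if k == 0 then +oo%E else (a ^+ 2 * D / (8 * k))%:E.
  by rewrite /s_entry2 /div_or_pinfty mulf_eq0 (_ : 8 == 0 = false)// pnatr_eq0.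
have e1 : s_entry1 p m D = if m == 0 then +oo%E else
    ((D / (4 * cp p * m)) `^ (1 / (p - 1)))%:E.
  rewrite /s_entry1 /div_or_pinfty !mulf_eq0 pnatr_eq0/= (gt_eqF hc)/=.
  by case: ifPn => // _; rewrite poweRyr// mulf_neq0// invr_eq0 subr_eq0 gt_eqF.
set ss := s_star a p m k D.
have ssE : ss%:E = mine (s_entry1 p m D) (mine (s_entry2 a k D) (s_entry3 a)).
  rewrite /ss /s_star e1 e2 /s_entry3; case: ifPn => _; case: ifPn => _;
  rewrite ?minye -?EFin_min//.
have le1 : (ss%:E <= s_entry1 p m D)%E by rewrite ssE ge_min lexx.
have le2 : (ss%:E <= s_entry2 a k D)%E by rewrite ssE !ge_min lexx !orbT.
have le3 : (ss%:E <= s_entry3 a)%E by rewrite ssE !ge_min lexx !orbT.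
have ss0 : 0 <= ss.
  rewrite -lee_fin ssE !le_min e1 e2 /s_entry3; apply/and3P; split.
  - by case: ifPn => _; rewrite ?leey// lee_fin powR_ge0.
  - case: ifPn => _; rewrite ?leey// lee_fin.
    by apply: divr_ge0; apply: mulr_ge0; rewrite ?sqr_ge0.
  - by rewrite lee_fin divr_ge0// ltW.
split => //.
- move: le2; rewrite e2; case: ifPn => [/eqP -> _|kn0].
    by rewrite mul0r; apply: divr_ge0 => //; apply: mulr_ge0; rewrite ?sqr_ge0.
  have kp : 0 < k by rewrite lt0r kn0.
  rewrite lee_fin ler_pdivlMr ?mulr_gt0//; nra.
- move: le1; rewrite e1; case: ifPn => [/eqP -> _|mn0].
    by rewrite mulr0 mul0r divr_ge0.
  have mp : 0 < m by rewrite lt0r mn0.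
  have cm : 0 < cp p * m by rewrite mulr_gt0.
  rewrite lee_fin => H.
  have q0 : 0 < p - 1 by rewrite subr_gt0.
  have : ss `^ (p - 1) <= ((D / (4 * cp p * m)) `^ (1 / (p - 1))) `^ (p - 1).
    by apply: ge0_ler_powR; rewrite ?nnegrE ?powR_ge0// ltW.
  rewrite -powRrM div1r mulVf ?gt_eqF// powRr1; last first.
    by rewrite divr_ge0 ?mulr_ge0// ltW.
  rewrite -mulrA ler_pdivlMr ?mulr_gt0//; nra.
Qed.

(** The constants 4, 8 and [a / 2] in the entries make each of the two penalty terms at most
    [s D / 4] at this [s], so half of [s D] survives. For the rational term, [s <= a / 2] gives
    [a (a - s) >= a^2 / 2]. *)
Lemma rate_ge_s_star : 2^-1 * s_star a p m k D * D <= rate a p m k D.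
Proof.
have [a0' p1' m0' k0' D0'] := And5 a0 p1 m0 k0 D0.
have := s_starP; move: (s_star a p m k D) => s [ss0 ss1 ss2 ss3].
have sa : 0 <= s < a by rewrite ss0/=; lra.
apply: le_trans (rate_ge sa).
have h1 : cp p * m * s `^ p <= s * D / 4.
  rewrite -mulr_powRB1//; last by lra.
  nra.
have h2 : k * s ^+ 2 / (a * (a - s)) <= s * D / 4.
  have as0 : 0 < a - s by lra.
  rewrite ler_pdivrMr ?mulr_gt0//.
  have : k * s ^+ 2 <= s * (a ^+ 2 * D / 8) by nra.
  move/le_trans; apply.
  have : a ^+ 2 / 2 <= a * (a - s) by nra.
  move=> /(ler_wpM2l (mulr_ge0 ss0 D0)); lra.
rewrite /mixed_bound; lra.
Qed.

Lemma rate_le_linear : rate a p m k D <= a * D.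
Proof.
have [a0' p1' m0' k0' D0'] := And5 a0 p1 m0 k0 D0.
apply: rate_le => s /andP[s0 sa].
have := mixed_bound_ge0 a0 hp m0 k0 sa; nra.
Qed.

(** Since [a (a - s) <= a^2], the penalty is at least [k s^2 / a^2]; completing the square maximises
    what remains. *)
Lemma rate_le_quadratic : 0 < k -> rate a p m k D <= a ^+ 2 * D ^+ 2 / (4 * k).
Proof.
have [a0' p1' m0' k0' D0'] := And5 a0 p1 m0 k0 D0.
move=> kp; apply: rate_le => s /andP[s0 sa].
have h : k * s ^+ 2 / a ^+ 2 <= mixed_bound a p m k s.
  rewrite /mixed_bound -[leLHS]add0r lerD//.
    by rewrite !mulr_ge0 ?powR_ge0// ltW// cp_gt0.
  rewrite ler_wpM2l ?mulr_ge0 ?sqr_ge0// lef_pV2 ?posrE ?exprn_gt0 ?mulr_gt0//; nra.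
have -> : a ^+ 2 * D ^+ 2 / (4 * k) =
    (s * D - k * s ^+ 2 / a ^+ 2) + (a * D / 2 - k * s / a) ^+ 2 / k.
  by field; rewrite !gt_eqF.
have : 0 <= (a * D / 2 - k * s / a) ^+ 2 / k by rewrite divr_ge0 ?sqr_ge0.
lra.
Qed.

(* Legendre transform of [c s^p], with maximiser [u]. *)
Lemma rate_le_power : 0 < m ->
  rate a p m k D <=
    (p - 1) / p * D * (D / (p * (cp p * m))) `^ (1 / (p - 1)).
Proof.
have [a0' p1' m0' k0' D0'] := And5 a0 p1 m0 k0 D0.
move=> mp; apply: rate_le => s /andP[s0 sa].
have cm : 0 < cp p * m by rewrite mulr_gt0// cp_gt0.
have h : cp p * m * s `^ p <= mixed_bound a p m k s.
  rewrite /mixed_bound lerDl.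
  by apply: divr_ge0; apply: mulr_ge0; rewrite ?sqr_ge0 ?subr_ge0// ltW.
set u := _ `^ (1 / (p - 1)).
have pc : 0 < p * (cp p * m) by rewrite mulr_gt0//; lra.
have u0 : 0 <= u by exact: powR_ge0.
have up : u `^ (p - 1) = D / (p * (cp p * m)).
  rewrite /u -powRrM div1r mulVf ?powRr1// ?divr_ge0 ?(ltW pc)//.
  by rewrite subr_eq0 gt_eqF.
have := powR_tangent p1 s0 u0.
rewrite -(@mulr_powRB1 _ u p) ?up//; last by lra.
move=> /(ler_wpM2l (ltW cm)).
have -> : cp p * m * (p * s * (D / (p * (cp p * m)))) = s * D.
  by field; rewrite !gt_eqF// ?cp_gt0//; lra.
have -> : cp p * m * (s `^ p + (p - 1) * (u * (D / (p * (cp p * m))))) =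
    cp p * m * s `^ p + (p - 1) / p * D * u.
  by field; rewrite !gt_eqF// ?cp_gt0//; lra.
lra.
Qed.

End rate.
End rate_bounds.

(** * Existence, uniqueness and optimality of the critical slope *)

Section optimal_slope.
Context {R : realType}.
Variables a p m k D : R.
Hypotheses (a0 : 0 < a) (hp : 1 < p <= 2) (m0 : 0 <= m) (k0 : 0 < k)
  (D0 : 0 < D).

Let p1 : 1 < p. Proof. by case/andP: hp. Qed.

(* The derivative of [mixed_bound a p m k]. *)
Let phi (r : R) : R :=
  p * cp p * m * r `^ (p - 1) + k * r * (2 * a - r) / (a * (a - r) ^+ 2).

(** In this form [r] enters the rational term only through [(a - r)^2], so strict monotonicity is
    visible. The strictness comes from [k > 0], as [m] may be 0. *)
Let phiE r : r < a ->
  phi r = p * cp p * m * r `^ (p - 1) + k / a * (a ^+ 2 / (a - r) ^+ 2 - 1).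
Proof.
move=> ra; rewrite /phi; congr (_ + _); field.
by rewrite (gt_eqF a0)/= subr_eq0 gt_eqF.
Qed.

Let phi_mono r u : 0 < r -> r < u -> u < a -> phi r < phi u.
Proof.
have [a0' p1' m0' k0' D0'] := And5 a0 p1 m0 k0 D0.
move=> r0 ru ua; rewrite !phiE//; last exact: lt_trans ua.
apply: ler_ltD.
  rewrite ler_wpM2l ?mulr_ge0 ?(ltW (cp_gt0 hp))//; first lra.
  by apply: ge0_ler_powR; rewrite ?nnegrE ?subr_ge0 ?ltW// (lt_trans r0).
rewrite ltr_pM2l ?divr_gt0// ltrD2r ltr_pM2l ?exprn_gt0//.
rewrite ltf_pV2 ?posrE ?exprn_gt0 ?subr_gt0 ?(lt_trans ru)//.
by rewrite ltrXn2r ?nnegrE ?subr_ge0 ?(ltW ua) ?(ltW (lt_trans ru ua))// ltrD2l ltrN2.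
Qed.

(** The left end is kept positive because continuity of [r^(p - 1)] is taken from its derivability,
    which fails at 0 when [p < 2]. *)
Let phi_continuous e b : 0 < e -> b < a -> {within `[e, b], continuous phi}.
Proof.
move=> e0 ba; apply: continuous_in_subspaceT => x.
rewrite inE/= in_itv/= => /andP[ex xb].
have x0 : 0 < x by exact: lt_le_trans ex.
have ax : a - x != 0 by rewrite subr_eq0 gt_eqF// (le_lt_trans xb).
apply: cvgD.
  apply: cvgM; first exact: cvg_cst.
  have : {for x, continuous (fun r : R => r `^ (p - 1))}.
    apply/differentiable_continuous/derivable1_diffP.
    by apply: derivable_powR; rewrite in_itv/= x0.
  exact.
apply: cvgM.
  apply: cvgM; first by apply: cvgM; [exact: cvg_cst|exact: cvg_id].
  by apply: cvgB; [exact: cvg_cst|exact: cvg_id].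
apply: cvgV; first by apply: mulf_neq0; [rewrite gt_eqF|exact: expf_neq0].
apply: cvgM; first exact: cvg_cst.
have h : (fun r : R => a - r) x @[x --> x] --> a - x.
  by apply: cvgB; [exact: cvg_cst|exact: cvg_id].
by under eq_fun do rewrite expr2; rewrite expr2; exact: cvgM.
Qed.

Let phi_root : exists2 r, 0 < r < a & phi r = D.
Proof.
have [a0' p1' m0' k0' D0'] := And5 a0 p1 m0 k0 D0.
have c0 := cp_gt0 hp.
set A := p * cp p * m.
have A0 : 0 <= A by rewrite !mulr_ge0// ?(ltW c0)//; lra.
(* A left end for the intermediate value theorem at which both terms of [phi] are at most [D / 2].
   The [A + 1] in [e1] keeps the quotient defined when [A = 0]; the 16 in [e2] absorbs
   [2 a - e <= 2 a] and [(a - e)^2 >= a^2 / 4]. *)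
have [e [e0 ea2 eA eK]] : exists e, [/\ 0 < e, e <= a / 2,
    A * e `^ (p - 1) <= D / 2 & k * e <= a ^+ 2 * D / 16].
  pose e1 := (D / (2 * (A + 1))) `^ (1 / (p - 1)).
  pose e2 := a ^+ 2 * D / (16 * k).
  have e10 : 0 < e1 by rewrite powR_gt0 ?divr_gt0//; lra.
  have e20 : 0 < e2 by rewrite /e2 divr_gt0 ?mulr_gt0 ?exprn_gt0.
  exists (Num.min (a / 2) (Num.min e1 e2)); split.
  - by rewrite !lt_min e10 e20 !andbT divr_gt0.
  - by rewrite ge_min lexx.
  - have h : A * e1 `^ (p - 1) <= D / 2.
      rewrite /e1 -powRrM div1r mulVf ?subr_eq0 ?gt_eqF// powRr1; last first.
        by apply: divr_ge0; lra.
      have -> : A * (D / (2 * (A + 1))) = D / 2 * (A / (A + 1)) by field; lra.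
      by rewrite ger_pMr ?divr_gt0// ler_pdivrMr; lra.
    apply: le_trans h; rewrite ler_wpM2l//; apply: ge0_ler_powR.
    + by rewrite subr_ge0 ltW.
    + by rewrite nnegrE ltW// !lt_min e10 e20 !andbT divr_gt0.
    + by rewrite nnegrE ltW.
    + by rewrite !ge_min lexx orbT.
  - have h : k * e2 <= a ^+ 2 * D / 16.
      by rewrite /e2 le_eqVlt; apply/orP; left; apply/eqP; field; rewrite gt_eqF.
    apply: le_trans h; rewrite ler_wpM2l ?(ltW k0)//.
    by rewrite !ge_min lexx !orbT.
have phie : phi e <= D.
  rewrite /phi -/A.
  suff : k * e * (2 * a - e) / (a * (a - e) ^+ 2) <= D / 2 by lra.
  have ae : 0 < a - e by lra.
  rewrite ler_pdivrMr ?mulr_gt0 ?exprn_gt0//.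
  have h1 : k * e * (2 * a - e) <= (a ^+ 2 * D / 16) * (2 * a) by nra.
  apply: (le_trans h1).
  have h2 : a ^+ 2 / 4 <= (a - e) ^+ 2 by nra.
  have h3 : 0 <= D * a by nra.
  have := ler_wpM2l h3 h2; rewrite !exprS !expr0; nra.
(* At the right end [a - d] the rational term alone is at least [k / d], because [d <= a / 2], and
   [k / d >= D]. *)
pose d := Num.min (a / 2) (k / D).
have d0 : 0 < d by rewrite lt_min !divr_gt0.
have da : d <= a / 2 by rewrite ge_min lexx.
have dk : d * D <= k by rewrite -ler_pdivlMr// ge_min lexx orbT.
have phib : D <= phi (a - d).
  rewrite /phi -/A.
  suff : D <= k * (a - d) * (2 * a - (a - d)) / (a * (a - (a - d)) ^+ 2).
    have : 0 <= A * (a - d) `^ (p - 1) by rewrite mulr_ge0 ?powR_ge0.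
    lra.
  have -> : a - (a - d) = d by ring.
  rewrite ler_pdivlMr ?mulr_gt0 ?exprn_gt0//.
  have h1 : k * d * a <= k * (a - d) * (2 * a - (a - d)).
    rewrite -mulrA -mulrA ler_pM2l//; nra.
  apply: le_trans h1.
  have := ler_wpM2r (ltW (mulr_gt0 d0 a0)) dk.
  rewrite !exprS !expr0; lra.
have eb : e <= a - d by lra.
have ba : a - d < a by lra.
have Dmin : Num.min (phi e) (phi (a - d)) <= D <= Num.max (phi e) (phi (a - d)).
  by rewrite ge_min phie/= le_max phib orbT.
have [r] := IVT eb (phi_continuous e0 ba) Dmin.
rewrite in_itv/= => /andP[er rb] <-.
by exists r => //; apply/andP; split; lra.
Qed.

(** Convexity without second derivatives: the power term is [powR_tangent], and the remainder of the
    rational term is an explicit square over a positive denominator. At a root of [phi u = D] it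
    says that [u] is a global maximiser. *)
Let tangent u s : 0 < u < a -> 0 <= s < a ->
  mixed_bound a p m k u + phi u * (s - u) <= mixed_bound a p m k s.
Proof.
have [a0' p1' m0' k0' D0'] := And5 a0 p1 m0 k0 D0.
move=> /andP[u0 ua] /andP[s0 sa]; rewrite /mixed_bound /phi.
have h1 : cp p * m * (p * s * u `^ (p - 1)) <=
    cp p * m * (s `^ p + (p - 1) * u `^ p).
  rewrite ler_wpM2l ?powR_tangent ?(ltW u0)//.
  by rewrite mulr_ge0// ltW// cp_gt0.
have eu : u `^ p = u * u `^ (p - 1) by rewrite mulr_powRB1 ?(ltW u0)//; lra.
have h2 : k * u ^+ 2 / (a * (a - u)) +
    k * u * (2 * a - u) / (a * (a - u) ^+ 2) * (s - u) <=
    k * s ^+ 2 / (a * (a - s)).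
  rewrite -subr_ge0.
  have -> : k * s ^+ 2 / (a * (a - s)) - (k * u ^+ 2 / (a * (a - u)) +
    k * u * (2 * a - u) / (a * (a - u) ^+ 2) * (s - u)) =
    k * a * (s - u) ^+ 2 / ((a - s) * (a - u) ^+ 2).
    by field; rewrite !subr_eq0 !gt_eqF.
  apply: divr_ge0; apply: mulr_ge0; rewrite ?sqr_ge0 ?subr_ge0//; try lra.
  by rewrite mulr_ge0// ltW.
move: h1; rewrite eu; nra.
Qed.

Lemma rate_attained : exists s, unique (fun r => 0 < r < a /\
    p * cp p * m * r `^ (p - 1) + k * r * (2 * a - r) / (a * (a - r) ^+ 2) = D) s
  /\ rate a p m k D = s * D - mixed_bound a p m k s.
Proof.
have [r ra phir] := phi_root.
exists r; split; [split => //|].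
- move=> u [ua phiu]; have [//|] := eqVneq r u.
  move: ra ua => /andP[r0 ra] /andP[u0 ua].
  rewrite neq_lt => /orP[/(phi_mono r0)/(_ ua)|/(phi_mono u0)/(_ ra)].
    by rewrite phir -[phi u]/(_ + _) phiu ltxx.
  by rewrite phir -[phi u]/(_ + _) phiu ltxx.
- apply/eqP; rewrite eq_le; apply/andP; split; last first.
    by apply: rate_ge; rewrite ?(ltW k0) ?(ltW D0)//; case/andP: ra => /ltW -> ->.
  apply: rate_le => // s sa.
  have := tangent ra sa; rewrite phir; lra.
Qed.

End optimal_slope.

(** * Comparison of the rate with its explicit lower bound *)

Section rate_ratio.
Context {R : realType}.
Variables a p m k D : R.
Hypotheses (a0 : 0 < a) (hp : 1 < p <= 2) (m0 : 0 <= m) (k0 : 0 <= k)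
  (D0 : 0 < D).

Let s1 := s_entry1 p m D.
Let s2 := s_entry2 a k D.
Let s3 : \bar R := s_entry3 a.
Let ss := s_star a p m k D.
Let ratio := rate a p m k D / (2^-1 * ss * D).

(** A zero denominator makes the quotient 0 by convention, which [B >= 0] covers; so nonnegativity
    of [ss] suffices. *)
Let ratio_le B : 0 <= B -> rate a p m k D <= B * (2^-1 * ss * D) -> ratio <= B.
Proof.
move=> B0 h; have [ss0 _ _ _] := s_starP a0 hp m0 k0 (ltW D0).
have : 0 <= 2^-1 * ss * D by rewrite !mulr_ge0// ltW.
rewrite /ratio le_eqVlt => /predU1P[<-|h0]; first by rewrite invr0 mulr0.
by rewrite ler_pdivrMr.
Qed.

Lemma ratio_le_entry1 : (s1 <= s2)%E -> (s1 <= s3)%E ->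
  ratio <= 2 * (p - 1) / p * (4 / p) `^ (1 / (p - 1)).
Proof.
have [a0' p1 m0' k0' D0'] := And5 a0 (proj1 (andP hp)) m0 k0 D0.
have c0 := cp_gt0 hp.
move=> h12 h13.
(* With [m = 0] the first entry would be [+oo], which cannot lie below the finite third entry. *)
have mp : 0 < m.
  rewrite lt0r m0 andbT; apply/eqP => m00; move: h13.
  rewrite /s1 /s_entry1 /div_or_pinfty m00 mulr0 eqxx poweRyr//.
  by rewrite div1r invr_eq0 subr_eq0 gt_eqF.
have c40 : 0 < 4 * cp p * m by rewrite !mulr_gt0.
have ssE : ss = (D / (4 * cp p * m)) `^ (1 / (p - 1)).
  rewrite /ss /s_star min_l; last by rewrite le_min; apply/andP.
  by rewrite /s_entry1 /div_or_pinfty gt_eqF.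
apply: ratio_le; first by rewrite !mulr_ge0 ?powR_ge0// ?invr_ge0; lra.
apply: le_trans (rate_le_power a0 hp m0 k0 (ltW D0) mp) _.
(* The maximiser of the power bound and [ss] are powers of the same quotient, so they differ by the
   constant factor [(4 / p)^(1 / (p - 1))]. *)
have -> : D / (p * (cp p * m)) = 4 / p * (D / (4 * cp p * m)).
  by field; rewrite !gt_eqF//; lra.
rewrite powRM ?divr_ge0 ?(ltW c40) ?(ltW D0)//; last lra.
rewrite -ssE.
by rewrite le_eqVlt; apply/orP; left; apply/eqP; field; rewrite !gt_eqF//; lra.
Qed.

(** The quadratic bound is [1/4], and the denominator [1/16], of [a^2 D^2 / k]. *)
Lemma ratio_le_entry2 : (s2 <= s1)%E -> (s2 <= s3)%E -> ratio <= 4.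
Proof.
move=> h21 h23.
have kp : 0 < k.
  rewrite lt0r k0 andbT; apply/eqP => k00; move: h23.
  by rewrite /s2 /s_entry2 /div_or_pinfty k00 mulr0 eqxx.
have ssE : ss = a ^+ 2 * D / (8 * k).
  rewrite /ss /s_star minCA min_l; last by rewrite le_min; apply/andP.
  by rewrite /s_entry2 /div_or_pinfty gt_eqF// mulr_gt0.
apply: ratio_le => //.
apply: le_trans (rate_le_quadratic a0 hp m0 k0 (ltW D0) kp) _.
rewrite ssE le_eqVlt; apply/orP; left; apply/eqP; field; rewrite gt_eqF//.
Qed.

Lemma ratio_le_entry3 : (s3 <= s1)%E -> (s3 <= s2)%E -> ratio <= 4.
Proof.
move=> h31 h32.
have ssE : ss = a / 2.
  by rewrite /ss /s_star [mine (s_entry2 _ _ _) _]min_r// min_r.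
apply: ratio_le => //.
apply: le_trans (rate_le_linear a0 hp m0 k0 (ltW D0)) _.
by rewrite ssE; lra.
Qed.

Lemma ratio_bounds :
  [/\ ratio <= Num.max 4 (2 * (p - 1) / p * (4 / p) `^ (1 / (p - 1))),
      (p = 2 -> (s1 <= s2)%E -> (s1 <= s3)%E -> ratio <= 2)
    & ((s2 <= s1)%E /\ (s2 <= s3)%E) \/ ((s3 <= s1)%E /\ (s3 <= s2)%E) ->
      ratio <= 4].
Proof.
split.
- have [h12|/ltW h21] := leP s1 s2; have [h13|/ltW h31] := leP s1 s3.
  + by rewrite le_max ratio_le_entry1// orbT.
  + by rewrite le_max ratio_le_entry3// (le_trans h31).
  + by rewrite le_max ratio_le_entry2// (le_trans h21).
  + have [h23|/ltW h32] := leP s2 s3.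
      by rewrite le_max ratio_le_entry2.
    by rewrite le_max ratio_le_entry3.
- move=> p2 h12 h13; apply: le_trans (ratio_le_entry1 h12 h13) _.
  rewrite p2 (_ : 2 - 1 = 1); last by ring.
  by rewrite divr1 powRr1; lra.
- by move=> [[? ?]|[? ?]]; [exact: ratio_le_entry2|exact: ratio_le_entry3].
Qed.

End rate_ratio.

(** * Conditional expectation *)

Section sub_sigma_algebra.
Context {d : measure_display} {T : measurableType d} {R : realType}.
Local Open Scope ereal_scope.
Variables (G : set (set T)).
Hypotheses (hG : sigma_algebra setT G) (GM : G `<=` measurable).

Lemma measurable_subE (B : set (g_sigma_algebraType G)) : measurable B <-> G B.
Proof.
rewrite -[in X in _ <-> X](sigma_algebra_id hG); split => //.
Qed.

(** The identity as a map to the coarser measurable space. Pushing [P] forward along it restricts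
    [P] to [G], which puts both measures of the Radon-Nikodym theorem on one space. *)
Definition to_sub (x : T) : g_sigma_algebraType G := x.

Lemma measurable_to_sub : measurable_fun setT to_sub.
Proof. by move=> _ B /measurable_subE/GM; rewrite setTI. Qed.

Lemma sub_measurableW d' (U : sigmaRingType d') (f : T -> U) :
  sub_measurable G f -> measurable_fun setT f.
Proof.
move=> mf _ B mB; rewrite setTI; apply: GM; apply/measurable_subE.
by have := mf measurableT B mB; rewrite setTI.
Qed.

Lemma sub_measurable_preimage d' (U : sigmaRingType d') (f : T -> U) B :
  sub_measurable G f -> measurable B -> G (f @^-1` B).
Proof.
by move=> mf mB; apply/measurable_subE; have := mf measurableT B mB; rewrite setTI.
Qed.

Lemma sub_measurableI (A B : set T) : G A -> G B -> G (A `&` B).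
Proof. by move=> /measurable_subE GA /measurable_subE GB; apply/measurable_subE/measurableI. Qed.

Variable P : probability T R.

HB.instance Definition _ := isMeasurableFun.Build _ _ _ _ to_sub measurable_to_sub.

Let Q : {finite_measure set (g_sigma_algebraType G) -> \bar R} :=
  (distribution P to_sub).

Let integral_to_sub (Y : T -> \bar R) A : sub_measurable G Y ->
  (forall w, 0 <= Y w) -> G A ->
  \int[Q]_(w in A) Y w = \int[P]_(w in A) Y w.
Proof.
move=> mY Y0 GA.
rewrite /Q/= /distribution ge0_integral_pushforward//.
- exact/measurable_subE.
- exact: measurable_funTS.
Qed.

Section density.
Variables (X : T -> \bar R) (X0 : forall w, 0 <= X w)
  (mX : measurable_fun setT X) (Xfin : \int[P]_w X w < +oo).

(* The measure with density [X], restricted to [G]. *)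
Let nu (A : set (g_sigma_algebraType G)) : \bar R := \int[P]_(w in A) X w.

Let nu0 : nu set0 = 0.
Proof. exact: integral_set0. Qed.

Let nu_ge0 A : 0 <= nu A.
Proof. by apply: integral_ge0 => x _; exact: X0. Qed.

Let nu_sigma_additive : semi_sigma_additive nu.
Proof.
move=> F mF tF mUF; rewrite /nu ge0_integral_bigcup//.
- by apply: is_cvg_ereal_nneg_natsum => n _; exact: integral_ge0.
- by move=> k; apply/GM/measurable_subE.
- exact: measurable_funTS.
Qed.

HB.instance Definition _ := isMeasure.Build _ _ _ nu
  nu0 nu_ge0 nu_sigma_additive.

Let nu_fin : fin_num_fun nu.
Proof. exact: lty_fin_num_fun. Qed.

HB.instance Definition _ := Measure_isFinite.Build _ _ _ nu nu_fin.

Let nu_dominated : nu `<< Q.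
Proof.
apply/null_content_dominatesP => A mA QA0; apply: null_set_integral => //.
- by apply: GM; apply/measurable_subE.
- exact: measurable_funTS.
Qed.

Lemma condexp_version_integrable : exists Y, condexp_ge0_version P G X Y.
Proof.
have [Y [Y0 /measurable_int mY YE]] := radon_nikodym_finite nu_dominated.
exists Y; split => // A GA.
by rewrite -integral_to_sub// -YE//; exact/measurable_subE.
Qed.

End density.

End sub_sigma_algebra.

Section conditional_expectation_bounds.
Context {d : measure_display} {T : measurableType d} {R : realType}.
Local Open Scope ereal_scope.
Variables (G : set (set T)).
Hypotheses (hG : sigma_algebra setT G) (GM : G `<=` measurable).
Variable P : probability T R.

(* Truncation: [X] is the sum of the bounded slices
   [min(X, n + 1) - min(X, n)]. *)
Lemma condexp_version_exists (X : T -> \bar R) : (forall w, 0 <= X w) ->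
  measurable_fun setT X -> exists Y, condexp_ge0_version P G X Y.
Proof.
move=> X0 mX.
pose x n w : R := fine (mine (X w) n%:R%:E).
have xE n w : (x n w)%:E = mine (X w) n%:R%:E.
  rewrite /x fineK// ge0_fin_numE ?le_min ?X0 ?lee_fin ?ler0n//.
  by rewrite gt_min ltry orbT.
have x_mono w n : (x n w <= x n.+1 w)%R.
  by rewrite -lee_fin !xE le_min !ge_min lexx/= lee_fin ler_nat leqnSn orbT.
pose S n w : \bar R := (x n.+1 w - x n w)%:E.
have S0 n w : 0 <= S n w by rewrite lee_fin subr_ge0.
have mS n : measurable_fun setT (S n).
  have mx k : measurable_fun setT (fun w => mine (X w) k%:R%:E).
    exact: measurable_mine.
  rewrite (_ : S n = fun w => mine (X w) n.+1%:R%:E - mine (X w) n%:R%:E).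
    exact: emeasurable_funB.
  by apply/funext => w; rewrite -!xE.
have S_fin n : \int[P]_w S n w < +oo.
  apply: (@le_lt_trans _ _ (\int[P]_w (cst n.+1%:R%:E) w)); last first.
    rewrite integral_cst//; apply: lte_mul_pinfty; rewrite ?lee_fin//.
    by apply: le_lt_trans (ltry 1); exact: probability_le1.
  apply: ge0_le_integral => // w _; rewrite /S /cst.
  apply: (@le_trans _ _ (x n.+1 w)%:E); last by rewrite xE ge_min lexx orbT.
  rewrite lee_fin gerBl -lee_fin xE le_min X0 lee_fin; exact: ler0n.
have XS w : X w = \sum_(n <oo) S n w.
  apply/esym/cvg_lim => //.
  rewrite (_ : (fun n => _) = fun n => mine (X w) n%:R%:E); last first.
    apply/funext => n; rewrite sumEFin telescope_sumr//.
    have -> : (x 0%N w = 0)%R by rewrite /x min_r.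
    by rewrite subr0 xE.
  have := X0 w; case: (X w) => [r r0|_|//].
    apply: cvg_near_cst; near=> n; apply/min_idPl; rewrite lee_fin.
    by near: n; exact: nbhs_infty_ger.
  rewrite (_ : (fun n => _) = fun n => n%:R%:E); last first.
    by apply/funext => n; rewrite minye.
  by apply/cvgenyP.
have /choice[Y hY] n := condexp_version_integrable hG GM (S0 n) (mS n) (S_fin n).
exists (fun w => \sum_(n <oo) Y n w); split.
- apply: ge0_emeasurable_sum => n; first by move=> w _ _; case: (hY n).
  by move=> _; case: (hY n).
- by move=> w; apply: nneseries_ge0 => n _ _; case: (hY n).
- move=> A GA; have mA := GM GA.
  rewrite integral_nneseries//; last 2 first.
    + move=> n; apply: measurable_funTS; apply: (sub_measurableW hG GM).
      by case: (hY n).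
    + by move=> n w _; case: (hY n).
  under [in RHS]eq_integral do rewrite XS.
  rewrite integral_nneseries//; last by move=> n; exact: measurable_funTS.
  by apply: eq_eseriesr => n _; case: (hY n) => _ _ ->.
Unshelve. all: by end_near. Qed.

Lemma condexp_ge0P (X : T -> \bar R) : (forall w, 0 <= X w) ->
  measurable_fun setT X -> condexp_ge0_version P G X (condexp_ge0 P G X).
Proof.
by move=> X0 mX; rewrite /condexp_ge0; case: xgetP => [Y ->//|H];
  have [Y /H] := condexp_version_exists X0 mX.
Qed.

(** Only almost sure, because the version chosen for the negative part, a conditional expectation of
    0, is itself only almost surely 0. *)
Lemma condexp_nneg (X : T -> \bar R) : (forall w, 0 <= X w) ->
  {ae P, forall w, condexp P G X w = condexp_ge0 P G X w}.
Proof.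
move=> X0.
have XN : X^\- = cst 0 by apply: funext => w; rewrite (@ge0_funenegE _ _ setT) ?inE.
have XP : X^\+ = X by apply: funext => w; rewrite (@ge0_funeposE _ _ setT) ?inE.
have [mZ Z0 ZE] := @condexp_ge0P (cst 0) (fun=> lexx _) (measurable_cst _).
have GT : G setT.
  by apply/(measurable_subE hG); exact: (@measurableT _ (g_sigma_algebraType G)).
have mZ' := sub_measurableW hG GM mZ.
have : \int[P]_w `|condexp_ge0 P G (cst 0) w| = 0.
  under eq_integral do rewrite gee0_abs//.
  by rewrite ZE// integral0.
move=> /(ae_eq_integral_abs P measurableT mZ'); apply: filterS => w /(_ I) Zw.
by rewrite /condexp XN XP Zw sube0.
Qed.

Lemma integral_le_of_condexp_le (X : T -> \bar R) (k : R) :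
  (forall w, 0 <= X w) -> measurable_fun setT X -> (0 <= k)%R ->
  {ae P, forall w, condexp P G X w <= k%:E} ->
  forall B, G B -> \int[P]_(w in B) X w <= k%:E * P B.
Proof.
move=> X0 mX k0 H B GB; have mB := GM GB.
have [mY Y0 YE] := condexp_ge0P X0 mX.
rewrite -YE// -integral_cst//; apply: ae_ge0_le_integral => //.
- by apply: measurable_funTS; exact: sub_measurableW mY.
- by move: H; apply: filterS2 (condexp_nneg X0) => w -> + _.
Qed.

(** A local converse of [integral_le_of_condexp_le]: testing on events inside one member of a
    countable cover is enough. The cover used later is by the events [|c| <= j]. *)
Lemma condexp_le_of_integral_le (X : T -> \bar R) (k : R) (A : nat -> set T) :
  (forall w, 0 <= X w) -> measurable_fun setT X -> (0 <= k)%R ->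
  (forall j, G (A j)) -> \bigcup_j A j = setT ->
  (forall j B, G B -> B `<=` A j -> \int[P]_(w in B) X w <= k%:E * P B) ->
  {ae P, forall w, condexp P G X w <= k%:E}.
Proof.
move=> X0 mX k0 GA AT H.
have [mY Y0 YE] := condexp_ge0P X0 mX.
set Y := condexp_ge0 P G X in mY Y0 YE.
(* These countably many events exhaust [Y > k]. On each, the integral of [Y] is at least
   [k + 1/(i + 1)] and at most [k] times its finite probability, so it is null. *)
pose N i j := A j `&` [set w | (k + i.+1%:R^-1)%:E <= Y w].
have GN i j : G (N i j).
  apply: (sub_measurableI hG) => //.
  rewrite (_ : [set w | _] = Y @^-1` `[(k + i.+1%:R^-1)%:E, +oo]%classic).
    by apply: (sub_measurable_preimage hG mY); exact: emeasurable_itv.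
  by apply/seteqP; split => w /=; rewrite in_itv/= leey andbT.
have N0 i j : P (N i j) = 0.
  have mN := GM (GN i j).
  have : (k + i.+1%:R^-1)%:E * P (N i j) <= k%:E * P (N i j).
    apply: (@le_trans _ _ (\int[P]_(w in N i j) Y w)); last first.
      by rewrite YE//; apply: (H j) => // w [].
    rewrite -integral_cst//; apply: ge0_le_integral => //.
    - by move=> w _; rewrite lee_fin addr_ge0 ?invr_ge0.
    - by apply: measurable_funTS; exact: sub_measurableW mY.
    - by move=> w [].
  have PN := fin_num_measure P _ mN.
  rewrite -(fineK PN) -!EFinM lee_fin mulrDl gerDl pmulr_rle0// => h.
  by apply/eqP; rewrite eqe eq_le h fine_ge0.
have : {ae P, forall w, forall i j, ~ N i j w}.
  apply/ae_foralln => i; apply/ae_foralln => j.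
  by exists (N i j); split; [exact: GM (GN i j)|exact: N0|move=> w /= /contrapT].
apply: filterS2 (condexp_nneg X0) => w -> Nw.
rewrite leNgt; apply/negP => kY.
have [j _ Ajw] : (\bigcup_j A j) w by rewrite AT.
have [i ki] : exists i : nat, (k + i.+1%:R^-1)%:E <= Y w.
  move: kY; rewrite -/(Y w); case: (Y w) => [y|_|//].
  - rewrite lte_fin => ky; exists (Num.truncn ((y - k)^-1)%R).
    have yk : (0 < y - k)%R by rewrite subr_gt0.
    rewrite lee_fin addrC -lerBrDr -[leRHS]invrK lef_pV2 ?posrE ?invr_gt0//.
    exact/ltW/truncnS_gt.
  - by exists 0%N; rewrite leey.
by apply: (Nw i j).
Qed.

End conditional_expectation_bounds.

(** * The one-step exponential bound *)

Section measurable_exp_ln.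
Context {R : realType}.
Local Open Scope ereal_scope.

Lemma measurable_expeR : measurable_fun setT (@expeR R).
Proof.
rewrite (_ : @expeR R = fun x => if x == +oo then +oo else
    if x == -oo then 0 else (expR (fine x))%:E); last first.
  by apply/funext; case.
apply: measurable_fun_ifT => //=; first exact: measurable_fun_eqe.
apply: measurable_fun_ifT => //=; first exact: measurable_fun_eqe.
apply/measurable_EFinP; apply: measurableT_comp => //.
Qed.

Lemma measurable_lne : measurable_fun setT (@lne R).
Proof.
rewrite (_ : @lne R = fun x => if x == +oo then +oo else
    if x <= 0 then -oo else (ln (fine x))%:E); last first.
  by apply/funext; case => [r| |]//; rewrite leNye.
apply: measurable_fun_ifT => //=; first exact: measurable_fun_eqe.
apply: measurable_fun_ifT => //=; first exact: measurable_fun_lee.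
apply/measurable_EFinP; apply: measurableT_comp => //.
Qed.

End measurable_exp_ln.

(** * Layer sums against an exponential tail *)

Section layers.
Context {R : realType}.
Implicit Types (a s h x : R) (H : R -> R).
Local Open Scope ereal_scope.

Definition increment H h (k : nat) : R := (H (k.+1%:R * h) - H (k%:R * h))%R.

Lemma increment_ge0 H h k : (0 < h)%R ->
  (forall x y, 0 <= x -> x <= y -> H x <= H y)%R -> (0 <= increment H h k)%R.
Proof.
move=> h0 Hh; rewrite subr_ge0 Hh ?mulr_ge0 ?(ltW h0)//.
by rewrite ler_pM2r// ler_nat.
Qed.

(* Layer cake with layers of width [h]: integrating it needs only countable
   sums, and it becomes sharp as [h] tends to 0. *)
Lemma le_layers H h x : (0 < h)%R -> H 0%R = 0%R ->
  (forall x y, 0 <= x -> x <= y -> H x <= H y)%R -> (0 <= x)%R ->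
  (H x)%:E <= \sum_(k <oo) (increment H h k * (k%:R * h <= x)%R%:R)%:E.
Proof.
move=> h0 H0 Hh x0.
have xh0 : (0 <= x / h)%R by rewrite divr_ge0// ltW.
set N := Num.truncn (x / h)%R.
have /andP[Nx xN] : (N%:R <= x / h < N.+1%:R)%R.
  exact: Num.Theory.truncn_itv.
apply: le_trans (nneseries_lim_ge N.+1 _); last first.
  by move=> k _; rewrite lee_fin mulr_ge0// increment_ge0.
rewrite sumEFin lee_fin.
rewrite (@telescope_sumr_eq _ 0%N N.+1 (fun k => H (k%:R * h)%R)) => // [|k kN].
  rewrite mul0r H0 subr0 Hh//.
  by rewrite -ler_pdivrMr// ?(ltW xN).
rewrite (_ : (k%:R * h <= x)%R = true) ?mulr1//.
by rewrite -ler_pdivlMr// (le_trans _ Nx)// ler_nat.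
Qed.

Lemma cvg_nneseries_EFin (f : nat -> R) (l : R) :
  series f @ \oo --> l -> \sum_(k <oo) (f k)%:E = l%:E.
Proof.
move=> fl; apply/cvg_lim => //.
rewrite (_ : (fun n => _) = EFin \o series f); last first.
  by apply/funext => n; rewrite /= sumEFin.
exact: cvg_comp fl _.
Qed.

Lemma cvg_geometric_expR a h : (0 < a)%R -> (0 < h)%R ->
  series (fun k : nat => expR (- (a * (k%:R * h)))) @ \oo -->
    ((1 - expR (- (a * h)))^-1)%R.
Proof.
move=> a0 h0; have ah : (0 < a * h)%R by rewrite mulr_gt0.
have q1 : (`|expR (- (a * h))| < 1)%R.
  by rewrite ger0_norm ?expR_ge0// expR_lt1 oppr_lt0.
have := @cvg_geometric_series R 1%R _ q1; rewrite mul1r.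
rewrite (_ : geometric _ _ = fun k : nat => expR (- (a * (k%:R * h))))//.
apply/funext => k /=; rewrite mul1r -expRM_natl; congr expR.
by rewrite mulrCA mulrN.
Qed.

(** The function [g] of the overview; its linear part is removed because the drift pays for it. *)
Definition exp_excess s x : R := (expR (s * x) - 1 - s * x)%R.

Lemma exp_excess0 s : exp_excess s 0 = 0%R.
Proof. by rewrite /exp_excess mulr0 expR0; ring. Qed.

Lemma exp_excess_mono s x y : (0 <= s)%R -> (0 <= x)%R -> (x <= y)%R ->
  (exp_excess s x <= exp_excess s y)%R.
Proof.
move=> s0 x0 xy.
have sx : (0 <= s * x)%R by rewrite mulr_ge0.
have sxy : (s * x <= s * y)%R by rewrite ler_wpM2l.
have : (expR (s * x) * (1 + (s * y - s * x)) <= expR (s * y))%R.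
  rewrite -[leRHS](_ : (expR (s * x) * expR (s * y - s * x) = _)%R).
    by rewrite ler_wpM2l ?expR_ge0// expR_ge1Dx.
  by rewrite -expRD addrC subrK.
have : (1 <= expR (s * x))%R by rewrite -expR0 ler_expR.
rewrite /exp_excess; nra.
Qed.

(** The exponential and linear parts of the increments give geometric series with ratios
    [e^(-(a - s) h)] and [e^(-a h)]; the first converges because [s < a]. The result discretises the
    integral of [(s e^(s x) - s) e^(-a x)], with a correction factor tending to 1 as [h] tends to
    0. *)
Lemma sum_exp_excess a s h : (0 <= s < a)%R -> (0 < h)%R ->
  \sum_(k <oo) (increment (exp_excess s) h k * expR (- (a * (k%:R * h))))%:E <=
  (s / (a - s) * (expR (s * h) * (1 + (a - s) * h)) - s / a)%:E.
Proof.
move=> /andP[s0 sa] h0.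
have b0 : (0 < a - s)%R by rewrite subr_gt0.
have a0 : (0 < a)%R by exact: le_lt_trans sa.
rewrite (@cvg_nneseries_EFin _ ((expR (s * h) - 1) *
    (1 - expR (- ((a - s) * h)))^-1 - (s * h) * (1 - expR (- (a * h)))^-1)%R);
    last first.
  rewrite (_ : series _ = fun n => ((expR (s * h) - 1) *
     series (fun k : nat => expR (- ((a - s) * (k%:R * h)))) n -
     (s * h) * series (fun k : nat => expR (- (a * (k%:R * h)))) n)%R).
    by apply: cvgB; apply: cvgMl_tmp; exact: cvg_geometric_expR.
  apply/funext => n; rewrite /series/= !mulr_sumr -sumrB; apply: eq_bigr => k _.
  rewrite /increment /exp_excess.
  have -> : (- ((a - s) * (k%:R * h)) = s * (k%:R * h) - a * (k%:R * h))%R by ring.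
  have -> : (s * (k.+1%:R * h) = s * h + s * (k%:R * h))%R.
    by rewrite -addn1 natrD; ring.
  by rewrite !expRD; ring.
rewrite lee_fin.
set q := expR (- ((a - s) * h)); set r := expR (- (a * h)).
have bh : (0 < (a - s) * h)%R by rewrite mulr_gt0.
have ah : (0 < a * h)%R by rewrite mulr_gt0.
have r1 : (0 < 1 - r)%R by rewrite subr_gt0 expR_lt1 oppr_lt0.
have q1 : (0 < 1 - q)%R by rewrite subr_gt0 expR_lt1 oppr_lt0.
apply: lerB.
(* With [b = a - s], this is combined with [1 - e^(-b h) >= b h / (1 + b h)]; both come from
   [e^x >= 1 + x]. *)
- have h1 : (expR (s * h) - 1 <= s * h * expR (s * h))%R.
    have := expR_ge1Dx (- (s * h)); rewrite expRN.
    have e0 := expR_gt0 (s * h)%R.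
    move=> /(ler_wpM2r (ltW e0)); rewrite mulVf ?gt_eqF//; lra.
  have h2 : ((a - s) * h <= (1 - q) * (1 + (a - s) * h))%R.
    have : (q * (1 + (a - s) * h) <= 1)%R.
      rewrite -[leRHS](_ : (q * expR ((a - s) * h) = 1)%R).
        by rewrite ler_wpM2l ?expR_ge0// expR_ge1Dx.
      by rewrite -expRD addNr expR0.
    lra.
  rewrite ler_pdivrMr//; apply: (le_trans h1).
  have -> : (s * h * expR (s * h) =
      s / (a - s) * expR (s * h) * ((a - s) * h))%R.
    by field; rewrite gt_eqF.
  have : (0 <= s / (a - s) * expR (s * h))%R.
    by rewrite !mulr_ge0 ?expR_ge0 ?invr_ge0 ?(ltW b0).
  move=> /ler_wpM2l/(_ _ _ h2)/le_trans; apply.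
  by rewrite le_eqVlt; apply/orP; left; apply/eqP; ring.
- have h3 : (1 - r <= a * h)%R by have := expR_ge1Dx (- (a * h)); rewrite -/r; lra.
  rewrite ler_pdivlMr//.
  apply: (@le_trans _ _ (s / a * (a * h))%R).
    by rewrite ler_wpM2l// divr_ge0// ltW.
  by rewrite le_eqVlt; apply/orP; left; apply/eqP; field; rewrite gt_eqF.
Qed.

(** For [x >= 0] this is the definition of [c_p] at [v = s x]; for [x <= 0] it is an equality by the
    choice of [exp_excess]. *)
Lemma exp_pointwise p s x : (1 < p <= 2)%R -> (0 <= s)%R ->
  (expR (- (s * x)) + s * Num.max x 0 <=
   1 + s * Num.max (- x) 0 + cp p * s `^ p * Num.max x 0 `^ p
     + exp_excess s (Num.max (- x) 0))%R.
Proof.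
move=> hp s0; have p0 : (p != 0)%R by rewrite gt_eqF//; move: hp; lra.
have [x0|/ltW x0] := leP 0%R x.
- rewrite [Num.max (- x)%R 0%R]max_r ?oppr_le0// exp_excess0.
  have := expRN_le_cp hp (mulr_ge0 s0 x0).
  rewrite powRM//; lra.
- by rewrite [Num.max (- x)%R 0%R]max_l ?oppr_ge0// powR0// /exp_excess mulrN; lra.
Qed.

End layers.

Section positive_part.
Context {R : realType}.
Implicit Types b c l y z : R.

(** The identity [(l - c)^+ - (l - c)^- = l^+ - l^- - c^+ + c^-] with every term moved to the side
    where it is positive, so that it can be integrated without finiteness conditions. *)
Lemma maxr0_sub l c :
  Num.max (l - c) 0 + (Num.max (- l) 0 + Num.max c 0) =
  Num.max (- (l - c)) 0 + (Num.max l 0 + Num.max (- c) 0).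
Proof. by rewrite !maxEle; do 6 case: ifP => //; lra. Qed.

Lemma maxr0_le_sub l c b : - b <= c <= b ->
  Num.max (- l) 0 + Num.max c 0 <= Num.max (- (l - c)) 0 + (b + b).
Proof. by rewrite !maxEle => /andP[]; do 3 case: ifP => //; lra. Qed.

Lemma le_sub_maxr0 c y z : c <= y - z ->
  z + Num.max c 0 <= y + Num.max (- c) 0.
Proof. by rewrite !maxEle; do 2 case: ifP => //; lra. Qed.

End positive_part.

Section one_step.
Context {d : measure_display} {T : measurableType d} {R : realType}.
Local Open Scope ereal_scope.
Variables (G : set (set T)).
Hypotheses (hG : sigma_algebra setT G) (GM : G `<=` measurable).
Variables (P : probability T R) (L : T -> \bar R) (c : T -> R).
Hypotheses (mL : measurable_fun setT L) (mcG : sub_measurable G c).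
Variables (a p K M : R).
Hypotheses (a0 : (0 < a)%R) (hp : (1 < p <= 2)%R) (K0 : (0 <= K)%R)
  (M0 : (0 <= M)%R).

Let D w := L w - (c w)%:E.

Hypothesis drift : {ae P, forall w, (c w)%:E <= condexp P G L w}.
Hypothesis tail : forall x : R, (0 <= x)%R -> {ae P, forall w,
  condprob P G [set w' | L w' <= (c w' - x)%:E] w <= (K * expR (- (a * x)))%:E}.
Hypothesis moment : {ae P, forall w,
  condexp P G (fun w' => poweR (maxe (L w' - (c w')%:E) 0) p) w <= M%:E}.

Let mc : measurable_fun setT c.
Proof. exact: sub_measurableW mcG. Qed.

Let mD : measurable_fun setT D.
Proof. by apply: emeasurable_funB => //; exact/measurable_EFinP. Qed.

Let Dp w := maxe (D w) 0.
Let Dm w := maxe (- D w) 0.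

Let mDp : measurable_fun setT Dp.
Proof. exact: measurable_maxe. Qed.

Let mDm : measurable_fun setT Dm.
Proof. by apply: measurable_maxe => //; exact: measurableT_comp. Qed.

Let Dp0 w : 0 <= Dp w. Proof. by rewrite le_max lexx orbT. Qed.
Let Dm0 w : 0 <= Dm w. Proof. by rewrite le_max lexx orbT. Qed.

Let GT : G setT.
Proof.
by apply/(measurable_subE hG); exact: (@measurableT _ (g_sigma_algebraType G)).
Qed.

Let tail_set x := [set w | L w <= (c w - x)%:E].

Let mtail x : measurable (tail_set x).
Proof.
rewrite -[tail_set x]setTI; apply: measurable_lee => //.
by apply/measurable_EFinP; exact: measurable_funB.
Qed.

Let tail_integral x B : (0 <= x)%R -> G B ->
  P (tail_set x `&` B) <= (K * expR (- (a * x)))%:E * P B.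
Proof.
move=> x0 GB; rewrite -integral_indic//; last exact: GM.
apply: (integral_le_of_condexp_le hG GM) => //.
- by apply/measurable_EFinP; exact: measurable_indic.
- by rewrite mulr_ge0 ?expR_ge0.
- exact: tail.
Qed.

Let moment_integral B : G B ->
  \int[P]_(w in B) poweR (Dp w) p <= M%:E * P B.
Proof.
move=> GB; apply: (integral_le_of_condexp_le hG GM) => // [w|].
- exact: poweR_ge0.
- exact: (measurableT_comp (measurable_poweR p) mDp).
Qed.

Let bet_gtNy : {ae P, forall w, -oo < L w}.
Proof.
have mNy : measurable [set w | L w = -oo].
  rewrite (_ : [set w | _] = setT `&` L @^-1` [set -oo]); last by rewrite setTI.
  exact: mL.
exists [set w | L w = -oo]; split => //.
- set N := [set w | _].
  have mN : measurable N by exact: mNy.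
  have PN := fin_num_measure P _ mN.
  set r := fine (P N).
  have H x : (0 <= x)%R -> (r <= K * expR (- (a * x)))%R.
    move=> x0; rewrite -lee_fin /r fineK//.
    apply: (@le_trans _ _ (P (tail_set x `&` setT))).
      apply: le_measure; rewrite ?inE//; first by rewrite setIT.
      by move=> w /= Lw; split => //; rewrite /tail_set/= Lw leNye.
    apply: le_trans (tail_integral x0 GT) _.
    by rewrite probability_setT mule1.
  have r0 : (0 <= r)%R by exact: fine_ge0.
  rewrite -[P N]fineK// -/r; congr EFin; apply/eqP; rewrite eq_le r0 andbT.
  rewrite leNgt; apply/negP => rp.
  have ra0 : (0 < r * a)%R by rewrite mulr_gt0.
  (* At [x = K / (r a)] the tail bound gives [r e^(a x) <= K], while
     [r e^(a x) >= r (1 + a x) = r + K]. *)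
  have x0 : (0 <= K / (r * a))%R by rewrite divr_ge0// ltW.
  have := H _ x0; rewrite expRN.
  have e0 := expR_gt0 (a * (K / (r * a)))%R.
  rewrite ler_pdivlMr// => h.
  have := ler_wpM2l r0 (expR_ge1Dx (a * (K / (r * a)))%R).
  have -> : (r * (1 + a * (K / (r * a))) = r + K)%R.
    by field; rewrite !gt_eqF.
  by move/le_trans/(_ h); lra.
- by move=> w /=; rewrite ltNye => /negP; rewrite negbK => /eqP.
Qed.

Let bet_lty : {ae P, forall w, L w < +oo}.
Proof.
have : P.-integrable setT (fun w => poweR (Dp w) p).
  apply/integrableP; split.
    exact: (measurableT_comp (measurable_poweR p) mDp).
  under eq_integral do rewrite gee0_abs ?poweR_ge0//.
  apply: le_lt_trans (moment_integral GT) _.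
  by rewrite probability_setT mule1 ltry.
move/(integrable_ae measurableT); apply: filterS => w /(_ I).
rewrite ltey; case Lw : (L w) => [r| |]//=.
by rewrite /Dp /D Lw -EFinN addye// maxye poweRyr// gt_eqF//; move: hp; lra.
Qed.

(** The tail hypothesis with [x] large excludes [-oo], and the finite moment excludes [+oo]. *)
Lemma bet_fin_num : {ae P, forall w, L w \is a fin_num}.
Proof.
by apply: filterS2 bet_gtNy bet_lty => w; rewrite fin_numElt => -> ->.
Qed.

Let layers H h w :=
  \sum_(k <oo) (increment H h k * \1_(tail_set (k%:R * h)) w)%:E.

Section layers.
Variables (H : R -> R) (h : R).
Hypotheses (h0 : (0 < h)%R) (H0 : H 0%R = 0%R)
  (Hh : forall x y, (0 <= x)%R -> (x <= y)%R -> (H x <= H y)%R).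

Let layer_ge0 k w : 0 <= (increment H h k * \1_(tail_set (k%:R * h)) w)%:E.
Proof. by rewrite lee_fin mulr_ge0// increment_ge0. Qed.

Let mlayer k :
  measurable_fun setT (fun w => (increment H h k * \1_(tail_set (k%:R * h)) w)%:E).
Proof. by apply/measurable_EFinP; apply: measurable_funM. Qed.

Let layers_ge0 w : 0 <= layers H h w.
Proof. exact: nneseries_ge0. Qed.

Let mlayers : measurable_fun setT (layers H h).
Proof. exact: ge0_emeasurable_sum. Qed.

Let le_layers_bet w (l : R) : L w = l%:E ->
  (H (Num.max (- (l - c w)) 0))%:E <= layers H h w.
Proof.
move=> Lw; have x0 : (0 <= Num.max (- (l - c w)) 0)%R by rewrite le_max lexx orbT.
have [y0|y0] := leP (- (l - c w))%R 0%R; first by rewrite H0.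
apply: (le_trans (le_layers h0 H0 Hh (ltW y0))).
apply: lee_nneseries => k _ //; first by rewrite lee_fin mulr_ge0// increment_ge0.
rewrite lee_fin ler_wpM2l ?increment_ge0//.
case: (leP (k%:R * h)%R _) => // kh.
rewrite indicE mem_set// /tail_set/= Lw lee_fin; lra.
Qed.

Let integral_layers B : G B ->
  \int[P]_(w in B) layers H h w <=
  (\sum_(k <oo) (increment H h k * expR (- (a * (k%:R * h))))%:E) * (K%:E * P B).
Proof.
move=> GB; have mB := GM GB.
have PB := fin_num_measure P _ mB.
have KP0 : 0 <= K%:E * P B by rewrite mule_ge0.
rewrite integral_nneseries//; last by move=> k; exact: measurable_funTS.
rewrite muleC -[P B]fineK// -EFinM -nneseriesZl; last first.
  by move=> k _; rewrite lee_fin mulr_ge0 ?expR_ge0 ?increment_ge0.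
apply: lee_nneseries => k _; first by move=> _; apply: integral_ge0.
under eq_integral do rewrite EFinM.
rewrite ge0_integralZl_EFin ?increment_ge0//; last first.
  by apply: measurable_funTS; apply/measurable_EFinP.
rewrite integral_indic//.
have kh0 : (0 <= k%:R * h)%R by rewrite mulr_ge0// ltW.
have := @lee_wpmul2l _ (increment H h k)%:E _ _ _ (tail_integral kh0 GB).
rewrite lee_fin => /(_ (increment_ge0 _ h0 Hh)) /le_trans; apply.
rewrite -(fineK PB) -!EFinM lee_fin le_eqVlt; apply/orP; left; apply/eqP; ring.
Qed.

(** General in [H] because it is used twice: [H = id] with [h = 1] shows that [x^-] is integrable,
    and [H = exp_excess s] gives the exponential estimate. *)
Lemma layersP : [/\ forall w, 0 <= layers H h w, measurable_fun setT (layers H h),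
  forall w l, L w = l%:E -> (H (Num.max (- (l - c w)) 0))%:E <= layers H h w
  & forall B, G B -> \int[P]_(w in B) layers H h w <=
    (\sum_(k <oo) (increment H h k * expR (- (a * (k%:R * h))))%:E) * (K%:E * P B)].
Proof. by split. Qed.

End layers.

Let DpE w (l : R) : L w = l%:E -> Dp w = (Num.max (l - c w) 0)%:E.
Proof. by move=> Lw; rewrite /Dp /D Lw EFin_max EFinB. Qed.

Let DmE w (l : R) : L w = l%:E -> Dm w = (Num.max (- (l - c w)) 0)%:E.
Proof. by move=> Lw; rewrite /Dm /D Lw EFin_max EFinN EFinB. Qed.

Let integral_Dm_lty B : G B -> \int[P]_(w in B) Dm w < +oo.
Proof.
move=> GB; have mB := GM GB.
have [l0 ml lD lint] := @layersP id 1%R ltr01 erefl (fun x y _ xy => xy).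
apply: (@le_lt_trans _ _ (\int[P]_(w in B) layers id 1%R w)).
  apply: ae_ge0_le_integral => //; [exact: measurable_funTS..|].
  apply: filterS bet_fin_num => w /fineK/esym Lw _.
  by rewrite (DmE Lw); exact: lD.
apply: le_lt_trans (lint _ GB) _.
have -> : \sum_(k <oo) (increment id 1 k * expR (- (a * (k%:R * 1))))%:E =
    ((1 - expR (- (a * 1)))^-1)%:E.
  apply: cvg_nneseries_EFin.
  rewrite (_ : (fun k => _) = fun k : nat => expR (- (a * (k%:R * 1)))%R).
    exact: cvg_geometric_expR.
  apply/funext => k; rewrite /increment -addn1 natrD !mulr1 /=.
  by rewrite (addrC k%:R) addrK mul1r.
by rewrite -[P B]fineK ?fin_num_measure// -!EFinM ltry.
Qed.

(** [eqD] integrates [maxr0_sub] and [leY] integrates the drift inequality. Comparing them requires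
    cancelling the integral of [L^- + c^+], which is finite since this sum is at most [x^- + 2 b] on
    [B]. *)
Let drift_integral (b : R) B : G B -> (forall w, B w -> `|c w| <= b)%R ->
  \int[P]_(w in B) Dm w <= \int[P]_(w in B) Dp w.
Proof.
move=> GB cb; have mB := GM GB.
pose cpos w := (Num.max (c w) 0)%:E; pose cneg w := (Num.max (- c w) 0)%:E.
have cpos0 w : 0 <= cpos w by rewrite lee_fin le_max lexx orbT.
have cneg0 w : 0 <= cneg w by rewrite lee_fin le_max lexx orbT.
have mcpos : measurable_fun setT cpos.
  by apply/measurable_EFinP; exact: measurable_maxr.
have mcneg : measurable_fun setT cneg.
  by apply/measurable_EFinP; apply: measurable_maxr => //; exact: measurableT_comp.
have mLp : measurable_fun setT L^\+ by exact: measurable_funepos.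
have mLn : measurable_fun setT L^\- by exact: measurable_funeneg.
have [mYp Yp0 YpE] := condexp_ge0P hG GM P (funepos_ge0 L) mLp.
have [mYn Yn0 YnE] := condexp_ge0P hG GM P (funeneg_ge0 L) mLn.
have mYp' := sub_measurableW hG GM mYp.
have mYn' := sub_measurableW hG GM mYn.
have eqD : \int[P]_(w in B) Dp w + \int[P]_(w in B) (L^\- w + cpos w) =
    \int[P]_(w in B) Dm w + \int[P]_(w in B) (L^\+ w + cneg w).
  rewrite -!ge0_integralD//; do ?[exact: measurable_funTS|
    by apply: measurable_funTS; exact: emeasurable_funD|
    by move=> w _; rewrite adde_ge0].
  apply: ge0_ae_eq_integral => //; do ?[
    by apply: measurable_funTS; apply: emeasurable_funD => //; exact: emeasurable_funD|
    by move=> w _; rewrite !adde_ge0].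
  apply: filterS bet_fin_num => w /fineK/esym Lw _.
  rewrite (DpE Lw) (DmE Lw) funeposE funenegE Lw /cpos /cneg.
  rewrite -EFinN -!EFin_max -!EFinD; congr EFin.
  exact: maxr0_sub.
have leY : \int[P]_(w in B) (L^\- w + cpos w) <=
    \int[P]_(w in B) (L^\+ w + cneg w).
  rewrite !ge0_integralD//; do ?exact: measurable_funTS.
  rewrite -YpE// -YnE//.
  rewrite -ge0_integralD//; do ?exact: measurable_funTS.
  rewrite -ge0_integralD//; do ?exact: measurable_funTS.
  apply: ae_ge0_le_integral => //; do ?[
    by apply: measurable_funTS; exact: emeasurable_funD|
    by move=> w _; rewrite !adde_ge0].
  apply: filterS drift => w + _; rewrite /condexp /cpos /cneg.
  have := Yp0 w; have := Yn0 w.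
  (* If the conditional [L^-] is infinite, the difference is [-oo] even when that of [L^+] is [+oo],
     contradicting the drift inequality; two cases remain. *)
  case: (condexp_ge0 P G L^\+ w) => [y| |]//; case: (condexp_ge0 P G L^\- w) => [z| |]//.
  + by move=> _ _; rewrite -EFinB !lee_fin; exact: le_sub_maxr0.
  + by move=> _ _ _; rewrite addye// leey.
have fin_u : \int[P]_(w in B) (L^\- w + cpos w) \is a fin_num.
  rewrite ge0_fin_numE; last by apply: integral_ge0 => w _; rewrite adde_ge0.
  apply: (@le_lt_trans _ _ (\int[P]_(w in B) (Dm w + (b + b)%:E))).
    apply: ae_ge0_le_integral => //.
    - by move=> w _; rewrite adde_ge0.
    - by apply: measurable_funTS; exact: emeasurable_funD.
    - move=> w Bw; rewrite adde_ge0// lee_fin addr_ge0//;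
      by rewrite (le_trans _ (cb w Bw)).
    - by apply: measurable_funTS; exact: emeasurable_funD.
    apply: filterS bet_fin_num => w /fineK/esym Lw Bw.
    have := cb w Bw; rewrite ler_norml => cbw.
    rewrite (DmE Lw) funenegE Lw /cpos -EFinN -!EFin_max -!EFinD lee_fin.
    exact: maxr0_le_sub.
  (* For an empty [B] the hypothesis on [b] is vacuous and [b] may be negative. *)
  have [->|/set0P[w0 Bw0]] := eqVneq B set0; first by rewrite integral_set0.
  have b0 : (0 <= b)%R by rewrite (le_trans _ (cb w0 Bw0)).
  rewrite ge0_integralD//; first last.
  - by move=> w _; rewrite lee_fin addr_ge0.
  - exact: measurable_funTS.
  rewrite integral_cst// lte_add_pinfty ?integral_Dm_lty//.
  apply: lte_mul_pinfty; rewrite ?lee_fin ?addr_ge0//.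
  by apply: le_lt_trans (ltry 1); exact: probability_le1.
by rewrite -(leeD2rE _ _ fin_u) eqD leeD2l.
Qed.

Section exponential.
Variable s : R.
Hypotheses (s0 : (0 <= s)%R) (sa : (s < a)%R).

Let Z w := expeR (- (s%:E * D w)).

Let mZ : measurable_fun setT Z.
Proof.
apply: (measurableT_comp measurable_expeR).
by apply: measurableT_comp => //; exact: measurable_funeM.
Qed.

Let Z0 w : 0 <= Z w. Proof. exact: expeR_ge0. Qed.

(* The bound at layer width [h]; it converges to the claim as [h -> 0]. *)
Let slack h : R := (1 + cp p * M * s `^ p
  + K * (s / (a - s) * (expR (s * h) * (1 + (a - s) * h)) - s / a))%R.

Let integral_exp_le_slack (b : R) B h : G B ->
  (forall w, B w -> `|c w| <= b)%R -> (0 < h)%R ->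
  \int[P]_(w in B) Z w <= (slack h)%:E * P B.
Proof.
move=> GB cb h0; have mB := GM GB.
have c0 := ltW (cp_gt0 hp).
have k0 : (0 <= cp p * s `^ p)%R by rewrite mulr_ge0 ?powR_ge0.
have [l0 ml lD lint] := @layersP (exp_excess s) h h0 (exp_excess0 s)
  (fun x y => @exp_excess_mono R s x y s0).
have mDpp : measurable_fun setT (fun w => poweR (Dp w) p).
  exact: (measurableT_comp (measurable_poweR p) mDp).
have Dpp0 w : 0 <= poweR (Dp w) p by exact: poweR_ge0.
have H1 : \int[P]_(w in B) (Z w + s%:E * Dp w) <=
    \int[P]_(w in B) (s%:E * Dm w + (1 + ((cp p * s `^ p)%:E * poweR (Dp w) p +
      layers (exp_excess s) h w))).
  apply: ae_ge0_le_integral => //.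
  - by move=> w _; rewrite adde_ge0// mule_ge0.
  - apply: measurable_funTS; apply: emeasurable_funD => //.
    exact: measurable_funeM.
  - by move=> w _; rewrite !adde_ge0// ?mule_ge0.
  - apply: measurable_funTS; apply: emeasurable_funD.
      exact: measurable_funeM.
    apply: emeasurable_funD => //; apply: emeasurable_funD => //.
    exact: measurable_funeM.
  apply: filterS bet_fin_num => w /fineK/esym Lw _.
  have := exp_pointwise (fine (L w) - c w)%R hp s0.
  move: (fine (L w)) Lw => l Lw h1.
  rewrite /Z /D (DpE Lw) (DmE Lw) Lw -EFinB poweR_EFin.
  apply: (@le_trans _ _ (s%:E * (Num.max (- (l - c w)) 0)%:E + (1 +
      ((cp p * s `^ p)%:E * (Num.max (l - c w) 0 `^ p)%:E +
       (exp_excess s (Num.max (- (l - c w)) 0))%:E)))).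
    by rewrite -!EFinM -EFinN /= -!EFinD lee_fin; lra.
  by do 3 apply: leeD2l; exact: lD.
move: H1; rewrite ge0_integralD//; first last.
- by apply: measurable_funTS; exact: measurable_funeM.
- by move=> w _; rewrite mule_ge0.
- exact: measurable_funTS.
rewrite ge0_integralZl_EFin//; last exact: measurable_funTS.
rewrite ge0_integralD//; first last.
- apply: measurable_funTS; apply: emeasurable_funD => //.
  by apply: emeasurable_funD => //; exact: measurable_funeM.
- by move=> w _; rewrite !adde_ge0// ?mule_ge0.
- by apply: measurable_funTS; exact: measurable_funeM.
- by move=> w _; rewrite mule_ge0.
rewrite ge0_integralZl_EFin//; last exact: measurable_funTS.
rewrite ge0_integralD//; first last.
- apply: measurable_funTS; apply: emeasurable_funD => //.
  exact: measurable_funeM.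
- by move=> w _; rewrite !adde_ge0// ?mule_ge0.
rewrite integral_cst// mul1e.
rewrite ge0_integralD//; first last.
- exact: measurable_funTS.
- by apply: measurable_funTS; exact: measurable_funeM.
- by move=> w _; rewrite mule_ge0.
rewrite ge0_integralZl_EFin//; last exact: measurable_funTS.
move=> H1.
have PB := fin_num_measure P _ mB.
have H2 : P B + ((cp p * s `^ p)%:E * \int[P]_(w in B) poweR (Dp w) p +
    \int[P]_(w in B) layers (exp_excess s) h w) <= (slack h)%:E * P B.
  have e1 : (cp p * s `^ p)%:E * \int[P]_(w in B) poweR (Dp w) p <=
      (cp p * s `^ p)%:E * (M%:E * P B).
    by rewrite lee_wpmul2l// moment_integral.
  have sa' : (0 <= s < a)%R by rewrite s0.
  have e2 : \int[P]_(w in B) layers (exp_excess s) h w <=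
      (s / (a - s) * (expR (s * h) * (1 + (a - s) * h)) - s / a)%:E * (K%:E * P B).
    apply: (le_trans (lint _ GB)); rewrite lee_wpmul2r ?mule_ge0//.
    exact: sum_exp_excess.
  apply: (le_trans (leeD2l _ (leeD e1 e2))).
  rewrite -[P B]fineK// -!EFinM -!EFinD lee_fin le_eqVlt; apply/orP; left.
  by apply/eqP; rewrite /slack; ring.
(* The integral of [s x^-] is added to both sides, exchanged on the left for that of [s x^+] by the
   drift, and then cancelled. *)
have fin_m : s%:E * \int[P]_(w in B) Dm w \is a fin_num.
  rewrite fin_numM// ge0_fin_numE ?integral_Dm_lty//.
  exact: integral_ge0.
rewrite -(leeD2rE _ _ fin_m).
apply: (@le_trans _ _ (\int[P]_(w in B) Z w + s%:E * \int[P]_(w in B) Dp w)).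
  by rewrite leeD2l// lee_wpmul2l// (drift_integral GB cb).
by apply: (le_trans H1); rewrite addeC leeD2r.
Qed.

Let integral_exp_le_bounded (b : R) B : G B ->
  (forall w, B w -> `|c w| <= b)%R ->
  \int[P]_(w in B) Z w <= (1 + mixed_bound a p M K s)%:E * P B.
Proof.
move=> GB cb.
have PB := fin_num_measure P _ (GM GB).
have int0 : 0 <= \int[P]_(w in B) Z w by exact: integral_ge0.
have zfin : \int[P]_(w in B) Z w \is a fin_num.
  rewrite ge0_fin_numE//.
  apply: le_lt_trans (integral_exp_le_slack GB cb ltr01) _.
  by rewrite -[P B]fineK// -EFinM ltry.
have := integral_exp_le_slack GB cb.
rewrite -[P B]fineK// -(fineK zfin); set z := fine _; set q := fine _ => H.
rewrite -EFinM lee_fin.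
have slack0 : slack 0%R = (1 + mixed_bound a p M K s)%R.
  rewrite /slack /mixed_bound !mulr0 expR0; field.
  by rewrite ?(gt_eqF a0) ?subr_eq0 ?(gt_eqF sa).
have cvg_slack : (slack h * q)%R @[h --> 0%R^'+] --> (slack 0 * q)%R.
  apply: cvg_at_right_filter.
  have cvg_scale (r : R) : (r * h)%R @[h --> 0%R] --> (r * 0)%R.
    by apply: cvgMl_tmp; exact: cvg_id.
  apply: cvgMr_tmp; apply: cvgD; first exact: cvg_cst.
  apply: cvgMl_tmp; apply: cvgB; last exact: cvg_cst.
  apply: cvgMl_tmp; apply: cvgM.
    by apply: (cvg_comp _ _ (cvg_scale s)); exact: continuous_expR.
  by apply: cvgD; [exact: cvg_cst|exact: cvg_scale].
rewrite -slack0; apply: (cvgr_to_ge cvg_slack).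
near=> h; rewrite -lee_fin EFinM; apply: H.
by near: h; exact: nbhs_right_gt.
Unshelve. all: by end_near. Qed.

Lemma condexp_exp_le : {ae P, forall w,
  condexp P G (fun w' => expeR (- (s%:E * (L w' - (c w')%:E)))) w <=
  (1 + mixed_bound a p M K s)%:E}.
Proof.
apply: (@condexp_le_of_integral_le _ _ _ _ hG GM _ _ _
  (fun j => [set w | (`|c w| <= j%:R)%R])) => //.
- by rewrite addr_ge0// mixed_bound_ge0.
- move=> j; rewrite (_ : [set w | _] = c @^-1` `[(- j%:R)%R, j%:R%R]%classic).
    by apply: (sub_measurable_preimage hG mcG); exact: measurable_itv.
  by apply/seteqP; split => w /=; rewrite in_itv/= ler_norml.
- apply/seteqP; split => // w _; exists (Num.truncn `|c w|).+1 => //=.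
  exact/ltW/truncnS_gt.
- by move=> j B GB Bj; apply: (@integral_exp_le_bounded j%:R%R).
Qed.

(** Passing through the conditional bound has removed the restriction to events on which [c] is
    bounded. *)
Lemma integral_exp_le B : G B ->
  \int[P]_(w in B) expeR (- (s%:E * (L w - (c w)%:E))) <=
  (1 + mixed_bound a p M K s)%:E * P B.
Proof.
apply: (integral_le_of_condexp_le hG GM Z0 mZ _ condexp_exp_le).
by rewrite addr_ge0// mixed_bound_ge0.
Qed.

End exponential.

End one_step.

(** * The Chernoff bound *)

Section weighted_integral.
Context {d : measure_display} {T : measurableType d} {R : realType}.
Local Open Scope ereal_scope.
Variables (G : set (set T)).
Hypotheses (hG : sigma_algebra setT G) (GM : G `<=` measurable).
Variables (P : probability T R).

Import HBNNSimple.

(** Takes the place of pulling a past-measurable factor out of a conditional expectation: the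
    hypothesis is the case of an indicator, simple functions follow by linearity, and general [V] by
    monotone convergence. *)
Lemma integral_weighted_le (Z V : T -> \bar R) (k : R) :
  (forall w, 0 <= Z w) -> measurable_fun setT Z -> (0 <= k)%R ->
  (forall B, G B -> \int[P]_(w in B) Z w <= k%:E * P B) ->
  sub_measurable G V -> (forall w, 0 <= V w) ->
  \int[P]_w (V w * Z w) <= k%:E * \int[P]_w V w.
Proof.
move=> Z0 mZ k0 HZ mV V0.
(* The approximation is built on the space carrying [G], so that its level sets belong to [G]. *)
pose f n := nnsfun_approx (@measurableT _ (g_sigma_algebraType G)) mV n.
pose g n (w : T) := (f n w)%:E.
have g0 n w : 0 <= g n w by rewrite lee_fin.
have mg n : measurable_fun setT (g n).
  apply: (sub_measurableW hG GM); rewrite /sub_measurable.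
  by apply/measurable_EFinP.
have g_nd w : {homo (g ^~ w) : m n / (m <= n)%N >-> m <= n}.
  move=> m n mn; rewrite lee_fin.
  have /lefP := nd_nnsfun_approx (@measurableT _ (g_sigma_algebraType G)) mV mn.
  exact.
have gV w : g ^~ w @ \oo --> V w.
  by apply: cvg_nnsfun_approx => //.
have gleV n w : g n w <= V w.
  rewrite -(cvg_unique _ (ereal_nondecreasing_cvgn (g_nd w)) (gV w))//.
  by apply: ereal_sup_ubound; exists n.
have VZ w : V w * Z w = limn (fun n => g n w * Z w).
  apply/esym/cvg_lim => //.
  (* The delicate case is [0 * +oo]: where [V] vanishes, so does every approximant, and the products
     are constantly 0. *)
  have [Zfin|] := boolP (Z w \is a fin_num); first exact: cvgeZr.
  rewrite ge0_fin_numE// -leNgt leye_eq => /eqP Zy.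
  have := V0 w; rewrite le_eqVlt => /predU1P[Vw|Vw].
    rewrite -Vw mul0e (_ : (fun n => _) = cst 0); first exact: cvg_cst.
    apply/funext => n /=; suff -> : g n w = 0 by rewrite mul0e.
    by apply/eqP; rewrite eq_le g0 andbT Vw gleV.
  apply: (cvgeM _ (gV w) (cvg_cst _)).
  by apply: mule_def_neq0_infty; rewrite ?Zy// gt_eqF.
under eq_integral do rewrite VZ.
rewrite monotone_convergence//; last 3 first.
- by move=> n; exact: emeasurable_funM.
- by move=> n w _; rewrite mule_ge0.
- by move=> w _ m n mn; rewrite lee_wpmul2r// g_nd.
apply: lime_le.
  apply: ereal_nondecreasing_is_cvgn => m n mn; apply: ge0_le_integral => //.
  - by move=> w _; rewrite mule_ge0.
  - exact: emeasurable_funM.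
  - exact: emeasurable_funM.
  - by move=> w _; rewrite lee_wpmul2r// g_nd.
apply: nearW => n.
apply: (@le_trans _ _ (k%:E * \int[P]_w g n w)); last first.
  rewrite lee_wpmul2l// ge0_le_integral//; exact: (sub_measurableW hG GM).
pose A y : set T := f n @^-1` [set y].
have GA y : G (A y).
  by apply/(measurable_subE hG); exact: measurable_funPTI.
have gE w : g n w = \sum_(y \in range (f n)) (y * \1_(A y) w)%:E.
  by rewrite /g fimfunE -fsumEFin.
have mgE y : measurable_fun setT (fun w => (y * \1_(A y) w)%:E).
  by apply/measurable_EFinP; apply: measurable_funM => //; apply: measurable_indic; exact: GM.
have gE0 y w : 0 <= (y * \1_(A y) w)%:E.
  exact: (nnfun_muleindic_ge0 (f n)).
under eq_integral do rewrite gE.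
under [X in _ <= _ * X]eq_integral do rewrite gE.
rewrite ge0_integral_fsum//.
under eq_integral do rewrite ge0_mule_fsuml//.
rewrite ge0_integral_fsum//; last 2 first.
- by move=> y; exact: emeasurable_funM.
- by move=> y w _; rewrite mule_ge0.
rewrite ge0_mule_fsumr; last by move=> y; exact: integral_ge0.
apply: lee_fsum => // y [w _ <-].
have y0 : (0 <= f n w)%R by [].
move: (f n w) y0 => r r0.
under eq_integral do rewrite EFinM -muleA.
rewrite ge0_integralZl_EFin//; last 2 first.
- by move=> x _; rewrite mule_ge0// lee_fin.
- apply: emeasurable_funM => //; apply/measurable_EFinP; apply: measurable_indic; exact: GM.
under [X in _ <= _ * X]eq_integral do rewrite EFinM.
rewrite ge0_integralZl_EFin//; last first.
  by apply/measurable_EFinP; apply: measurable_indic; exact: GM.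
rewrite muleCA lee_wpmul2l//.
rewrite integral_indic ?setIT//; last exact: GM.
have -> : \int[P]_x ((\1_(A r) x)%:E * Z x) = \int[P]_(x in A r) Z x.
  rewrite [RHS]integral_mkcond; apply: eq_integral => x _.
  by rewrite epatch_indic muleC.
exact: HZ.
Qed.

End weighted_integral.

Section chernoff.
Context {d : measure_display} {T : measurableType d} {R : realType}.
Local Open Scope ereal_scope.

Lemma sub_measurable_mono (G G' : set (set T)) d' (U : sigmaRingType d')
    (f : T -> U) : sigma_algebra setT G -> sigma_algebra setT G' ->
  G `<=` G' -> sub_measurable G f -> sub_measurable G' f.
Proof.
move=> hG hG' GG' mf _ B mB; rewrite setTI; apply/(measurable_subE hG').
exact/GG'/(sub_measurable_preimage hG mf mB).
Qed.

Lemma log_betK (E : nat -> T -> \bar R) n w (l : R) : 0 <= E n w ->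
  log_bet E n w = l%:E -> E n w = (expR l)%:E.
Proof.
by move=> E0 h; rewrite -[LHS]lneK ?in_itv/= ?E0 ?leey// -/(log_bet E n w) h.
Qed.

Section crossing.
Variables (F : nat -> set (set T)) (hF : filtration F) (P0 P1 : probability T R).
Variables (E : nat -> T -> \bar R) (hE : betting_sequence F P0 E).

Lemma measurable_bet n : (0 < n)%N -> measurable_fun setT (E n).
Proof.
case: hF => hs hm _ _ n0; case: (hE n0) => mE _ _.
exact: (sub_measurableW (hs n) (@hm n) mE).
Qed.

Lemma measurable_wealth n : measurable_fun setT (wealth E n).
Proof.
elim: n => [|n ih].
  rewrite (_ : wealth E 0 = cst 1)//.
  by apply/funext => w; rewrite /wealth big_nil.
rewrite (_ : wealth E n.+1 = wealth E n \* E n.+1).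
  by apply: emeasurable_funM => //; exact: measurable_bet.
by apply/funext => w; rewrite /wealth big_nat_recr.
Qed.

Lemma measurable_wealth_le n (x : \bar R) : measurable [set w | wealth E n w <= x].
Proof.
rewrite -[X in measurable X]setTI; apply: measurable_lee => //.
exact: measurable_wealth.
Qed.

Lemma running_type2_error_le alpha t : (0 < t)%N ->
  running_type2_error P1 E alpha t <= type2_error P1 E alpha t.
Proof.
move=> t0.
have -> : running_type2_error P1 E alpha t = P1 (\bigcap_(n in [set n | 0 < n <= t]%N)
    [set w | wealth E n w <= (alpha^-1)%:E]).
  congr (P1 _); apply/seteqP; split => w /=.
    move=> tw n /= /andP[n0 nt]; rewrite leNgt; apply/negP => nW.
    have : crossing_time E alpha w <= n%:R%:E.
      by apply: ereal_inf_lbound; exists n.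
    by move=> /(lt_le_trans tw); rewrite lte_fin ltr_nat ltnNge nt.
  (* Without a crossing up to [t] the infimum is at least [t + 1], also when it is [+oo]; this gap
     gives the strict inequality. *)
  move=> tw; apply: (@lt_le_trans _ _ t.+1%:R%:E).
    by rewrite lte_fin ltr_nat.
  apply: le_ereal_inf_tmp => _ [n [n0 nW] <-]; rewrite lee_fin ler_nat ltnNge.
  apply/negP => nt; have := tw n; rewrite /= n0 nt => /(_ isT).
  by rewrite leNgt nW.
apply: le_measure; rewrite ?inE.
- by apply: bigcap_measurable => [|n _]; [exists t; rewrite /= t0 leqnn|
    exact: measurable_wealth_le].
- exact: measurable_wealth_le.
- by move=> w; apply; rewrite /= t0 leqnn.
Qed.

End crossing.

Section exponential_product.
Variables (F : nat -> set (set T)) (hF : filtration F) (P0 P1 : probability T R).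
Variables (E : nat -> T -> \bar R) (hE : betting_sequence F P0 E).
Variables (c : nat -> T -> R) (mc : forall n, (0 < n)%N -> sub_measurable (F n.-1) (c n)).
Variables (s : R) (psi : nat -> R).

Let Z n w := expeR (- (s%:E * (log_bet E n w - (c n w)%:E))).
Let V t w := \prod_(1 <= n < t.+1) Z n w.

Let mZ n : (0 < n)%N -> sub_measurable (F n) (Z n).
Proof.
case: hF => hs _ hmono _ n0; case: (hE n0) => mE _ _.
have mcn : sub_measurable (F n) (c n).
  exact: (sub_measurable_mono (hs n.-1) (hs n) (hmono _ _ (leq_pred n)) (mc n0)).
apply: (measurableT_comp measurable_expeR).
apply: (@measurableT_comp _ _ _ _ _ _ (@oppe R)) => //.
apply: measurable_funeM.
apply: emeasurable_funB; first exact: (measurableT_comp measurable_lne).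
exact/measurable_EFinP.
Qed.

Let Z0 n w : 0 <= Z n w. Proof. exact: expeR_ge0. Qed.

Let VS t w : V t.+1 w = V t w * Z t.+1 w.
Proof. by rewrite /V big_nat_recr. Qed.

Let V0 t w : 0 <= V t w.
Proof. by rewrite /V; apply: prode_ge0. Qed.

Let mV t : sub_measurable (F t) (V t).
Proof.
case: (hF) => hs _ hmono _; elim: t => [|t ih].
  rewrite (_ : V 0 = cst 1); first exact: measurable_cst.
  by apply/funext => w; rewrite /V big_nil.
rewrite (_ : V t.+1 = V t \* Z t.+1); last by apply/funext => w; exact: VS.
apply: emeasurable_funM; last exact: mZ.
exact: (sub_measurable_mono (hs t) (hs t.+1) (hmono _ _ (leqnSn t)) ih).
Qed.

Hypothesis psi0 : forall n, (0 < n)%N -> (0 <= psi n)%R.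
Hypothesis HZ : forall n, (0 < n)%N -> forall B, F n.-1 B ->
  \int[P1]_(w in B) Z n w <= (1 + psi n)%:E * P1 B.

(** Induction on [t]: [V t] is measurable for the past of step [t + 1], so it acts as the weight for
    the next factor, and [1 + x <= e^x] turns the product into the exponential of a sum. *)
Let integral_exp_product_le t :
  \int[P1]_w V t w <= (expR (\sum_(1 <= n < t.+1) psi n))%:E.
Proof.
case: (hF) => hs hm _ _; elim: t => [|t ih].
  rewrite big_nil expR0 (eq_integral (cst 1)); last first.
    by move=> w _; rewrite /V big_nil.
  by rewrite integral_cst// mul1e; exact: probability_le1.
under eq_integral do rewrite VS.
apply: (@le_trans _ _ ((1 + psi t.+1)%:E * \int[P1]_w V t w)).
  apply: (integral_weighted_le (hs t) (@hm t) (Z0 t.+1)) => //.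
  - exact: (sub_measurableW (hs t.+1) (@hm t.+1) (mZ (ltn0Sn t))).
  - by rewrite addr_ge0// psi0.
  - exact: (HZ (ltn0Sn t)).
apply: (@le_trans _ _ ((1 + psi t.+1)%:E * (expR (\sum_(1 <= n < t.+1) psi n))%:E)).
  by rewrite lee_wpmul2l// lee_fin addr_ge0// psi0.
rewrite -EFinM lee_fin [in leRHS]big_nat_recr//= expRD mulrC.
by rewrite ler_wpM2l ?expR_ge0// expR_ge1Dx.
Qed.

Let wealth_exp t w (l : nat -> R) :
  (forall n, (0 < n)%N -> log_bet E n w = (l n)%:E) ->
  wealth E t w = (expR (\sum_(1 <= n < t.+1) l n))%:E /\
  V t w = (expR (- (s * (\sum_(1 <= n < t.+1) l n - \sum_(1 <= n < t.+1) c n w))))%:E.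
Proof.
move=> Ll; elim: t => [|t [ihW ihV]].
  by rewrite /wealth /V !big_nil subr0 mulr0 oppr0 expR0.
split.
  rewrite /wealth big_nat_recr//= -/(wealth E t w) ihW.
  case: (hE (ltn0Sn t)) => _ E0 _.
  by rewrite (log_betK (E0 w) (Ll _ (ltn0Sn t))) -EFinM -expRD [in RHS]big_nat_recr.
rewrite VS ihV /Z Ll//= -EFinM -expRD.
by congr (expR _)%:E; rewrite !(@big_nat_recr _ _ _ t.+1)//=; ring.
Qed.

Lemma chernoff_type2_error t alpha C : (0 < alpha)%R -> (0 <= s)%R ->
  {ae P1, forall w, (C <= \sum_(1 <= n < t.+1) c n w)%R} ->
  (forall n, (0 < n)%N -> {ae P1, forall w, log_bet E n w \is a fin_num}) ->
  type2_error P1 E alpha t <=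
    (expR (- (s * log_margin alpha C - \sum_(1 <= n < t.+1) psi n)))%:E.
Proof.
move=> a0 s0 hC hL; rewrite /log_margin.
set N := [set w | wealth E t w <= (alpha^-1)%:E].
have mN : measurable N by exact: (measurable_wealth_le hF hE).
have PN := fin_num_measure P1 _ mN.
(* A nonpositive difference makes the margin 0, and the claimed bound is then at least 1. *)
have [CL|/ltW LC] := leP (C - ln alpha^-1)%R 0%R.
  rewrite mulr0 sub0r opprK.
  apply: (le_trans (probability_le1 P1 mN)); rewrite lee_fin -expR0 ler_expR.
  by rewrite big_nat_cond sumr_ge0// => n /andP[/andP[n0 _] _]; exact: psi0.
set D := (C - ln alpha^-1)%R in LC *.
have mVT : measurable_fun setT (V t).
  case: (hF) => hs hm _ _; exact: (sub_measurableW (hs t) (@hm t) (@mV t)).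
(* Markov's inequality: on [N] the logarithms sum to at most [ln (1 / alpha)] and the drifts to at
   least [C], so [V t] is at least [e^(s D)] there almost surely. *)
have H : (expR (s * D))%:E * P1 N <= (expR (\sum_(1 <= n < t.+1) psi n))%:E.
  apply: (le_trans _ (integral_exp_product_le t)).
  apply: (@le_trans _ _ (\int[P1]_(w in N) V t w)); last first.
    apply: ge0_subset_integral => //.
  rewrite -integral_cst//; apply: ae_ge0_le_integral => //.
  - by move=> w _; rewrite lee_fin expR_ge0.
  - exact: measurable_funTS.
  have hL' : {ae P1, forall w, forall n, (0 < n)%N -> log_bet E n w \is a fin_num}.
    apply/ae_foralln => n; case: (posnP n) => [->|n0].
      by apply: aeW.
    by apply: filterS (hL n n0).
  apply: filterS2 hC hL' => w Cw Lw Nw.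
  have [Wl Vl] := @wealth_exp t w (fun n => fine (log_bet E n w))
    (fun n n0 => esym (fineK (Lw n n0))).
  move: Nw; rewrite /N /= Wl Vl !lee_fin.
  rewrite -[X in (_ <= X)%R -> _]lnK ?posrE ?invr_gt0// !ler_expR => h.
  by rewrite -mulrN ler_wpM2l// /D; lra.
move: H; rewrite -[P1 N]fineK// -EFinM !lee_fin /type2_error -/N.
rewrite -[P1 N]fineK// lee_fin opprB expRD expRN ler_pdivlMr ?expR_gt0//.
by rewrite mulrC.
Qed.

End exponential_product.
End chernoff.

Theorem corollary4p9
  (d : measure_display) (T : measurableType d) (R : realType)
  (F : nat -> set (set T)) (hF : filtration F)
  (P0 P1 : probability T R) (hP : locally_abs_continuous F P1 P0)
  (E : nat -> T -> \bar R) (hE : betting_sequence F P0 E)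
  (c : nat -> T -> R) (hc : drift_certificate F P1 E c)
  (t : nat) (ht : (0 < t)%N)
  (alpha : R) (halpha : 0 < alpha < 1)
  (C : R) (hC : {ae P1, forall w, C <= \sum_(1 <= n < t.+1) c n w})
  (a p : R) (ha : 0 < a) (hp : 1 < p <= 2)
  (Kn Mn : nat -> R)
  (hKn : forall n, (0 < n)%N -> 0 <= Kn n)
  (hMn : forall n, (0 < n)%N -> 0 <= Mn n)
  (htail : forall n, (0 < n)%N -> forall x : R, 0 <= x ->
     {ae P1, forall w,
        (condprob P1 (F n.-1)
           [set w' | log_bet E n w' <= (c n w' - x)%:E] w
         <= (Kn n * expR (- (a * x)))%:E)%E})
  (hmoment : forall n, (0 < n)%N ->
     {ae P1, forall w,
        (condexp P1 (F n.-1)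
           (fun w' => poweR (maxe (log_bet E n w' - (c n w')%:E) 0) p) w
         <= (Mn n)%:E)%E})
  (K M : R)
  (hK : \sum_(1 <= n < t.+1) Kn n <= K)
  (hM : \sum_(1 <= n < t.+1) Mn n <= M) :
  let Delta := log_margin alpha C in
  let psi := fun (n : nat) (s : R) (_ : T) =>
    (mixed_bound a p (Mn n) (Kn n) s)%:E in
  let Psi := fun s : R => (mixed_bound a p M K s)%:E in
  let s1 := s_entry1 p M Delta in
  let s2 := s_entry2 a K Delta in
  let s3 := s_entry3 a in
  let ss := s_star a p M K Delta in
  let ratio := rate a p M K Delta / (2^-1 * ss * Delta) in
  [/\ [/\ has_sup (cp_set p), cp p <= 2 `^ (1 - p) & cp (2 : R) = 2^-1],
      [/\ majorant F P1 E c a psi,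
          forall s, 0 <= s < a ->
            \sum_(1 <= n < t.+1) mixed_bound a p (Mn n) (Kn n) s
            <= mixed_bound a p M K s
        & aggregate P1 c a psi t C Psi],
      [/\ (running_type2_error P1 E alpha t <= type2_error P1 E alpha t)%E,
          (type2_error P1 E alpha t <= (expR (- rate a p M K Delta))%:E)%E
        & expR (- rate a p M K Delta) <= expR (- (2^-1 * ss * Delta))],
      (0 < K -> 0 < Delta ->
         exists s,
           unique (fun r => 0 < r < a /\
             p * cp p * M * r `^ (p - 1)
               + K * r * (2 * a - r) / (a * (a - r) ^+ 2) = Delta) s /\
           rate a p M K Delta = s * Delta - mixed_bound a p M K s)
    & (0 < Delta ->
         [/\ ratio <= Num.max 4 (2 * (p - 1) / p * (4 / p) `^ (1 / (p - 1))),
             (p = 2 -> (s1 <= s2)%E -> (s1 <= s3)%E -> ratio <= 2)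
           & ((s2 <= s1)%E /\ (s2 <= s3)%E) \/ ((s3 <= s1)%E /\ (s3 <= s2)%E) ->
             ratio <= 4])].
Proof.
have [hs hm _ _] := hF.
have M0 : 0 <= M.
  apply: le_trans hM; rewrite big_nat_cond sumr_ge0// => n /andP[/andP[n0 _] _].
  exact: hMn.
have K0 : 0 <= K.
  apply: le_trans hK; rewrite big_nat_cond sumr_ge0// => n /andP[/andP[n0 _] _].
  exact: hKn.
have alpha0 : 0 < alpha by case/andP: halpha.
move=> Delta psi Psi s1 s2 s3 ss ratio.
have Delta0 : 0 <= Delta by rewrite /Delta /log_margin le_max lexx orbT.
have mL n : (0 < n)%N -> measurable_fun setT (log_bet E n).
  by move=> n0; apply: (measurableT_comp measurable_lne); exact: (measurable_bet hF hE).
have mc n : (0 < n)%N -> sub_measurable (F n.-1) (c n).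
  by move=> n0; case: (hc n n0).
have drift n : (0 < n)%N ->
    {ae P1, forall w, ((c n w)%:E <= condexp P1 (F n.-1) (log_bet E n) w)%E}.
  by move=> n0; case: (hc n n0).
have Lfin n : (0 < n)%N -> {ae P1, forall w, log_bet E n w \is a fin_num}.
  move=> n0.
  exact: (bet_fin_num (hs n.-1) (@hm n.-1) (@mL n n0) (@mc n n0) ha hp
    (@hKn n n0) (@hMn n n0) (@htail n n0) (@hmoment n n0)).
have psi_ge0 n s : (0 < n)%N -> s < a -> 0 <= mixed_bound a p (Mn n) (Kn n) s.
  by move=> n0 sa; rewrite mixed_bound_ge0// ?hMn ?hKn.
have sum_le s : s < a -> \sum_(1 <= n < t.+1) mixed_bound a p (Mn n) (Kn n) s
    <= mixed_bound a p M K s.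
  by move=> sa; rewrite sum_mixed_bound le_mixed_bound.
split.
- by split; [exact: has_sup_cp_set|exact: cp_le|exact: cp2].
- split => [|s /andP[_ sa]|]; [|exact: sum_le|].
  + move=> n n0; split => [w|s /andP[s0 sa]].
      by rewrite /psi mixed_bound0//; case/andP: hp.
    split => [|w|]; [exact: measurable_cst|by rewrite lee_fin psi_ge0|].
    have := condexp_exp_le (hs n.-1) (@hm n.-1) (@mL n n0) (@mc n n0) ha hp
      (@hKn n n0) (@hMn n n0) (@drift n n0) (@htail n n0) (@hmoment n n0) s0 sa.
    apply: filterS => w h; rewrite /cumulant /psi.
    have m0 := psi_ge0 n s n0 sa.
    (* Where the conditional expectation is at most 0, [lne] is [-oo]; elsewhere [lne] is monotone
       and [lne (1 + x) <= x]. *)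
    have [Y0|/ltW Y0] := leP (condexp P1 (F n.-1) (fun w' =>
        expeR (- (s%:E * (log_bet E n w' - (c n w')%:E))))%E w) 0%E.
      by rewrite le0_lneNy// leNye.
    apply: (@le_trans _ _ (lne (1 + (mixed_bound a p (Mn n) (Kn n) s)%:E)%E)).
      by rewrite lee_lne// in_itv/= ?Y0 ?leey// -EFinD lee_fin addr_ge0.
    by apply: le_lne1Dx; rewrite lee_fin (le_trans _ m0)// lerN10.
  + split => // s /andP[_ sa]; apply: aeW => w.
    by rewrite /psi sumEFin lee_fin sum_le.
- split; [exact: (running_type2_error_le hF P1 hE)| |]; last first.
    by rewrite ler_expR lerN2 rate_ge_s_star.
  have chernoff s : 0 <= s < a ->
      (type2_error P1 E alpha t <=
       (expR (- (s * Delta - mixed_bound a p M K s)))%:E)%E.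
    move=> /andP[s0 sa].
    have HZ n (n0 : (0 < n)%N) := @integral_exp_le _ _ _ _ (hs n.-1) (@hm n.-1)
      _ _ _ (@mL n n0) (@mc n n0) _ _ _ _ ha hp
      (@hKn n n0) (@hMn n n0) (@drift n n0) (@htail n n0) (@hmoment n n0) _ s0 sa.
    apply: (le_trans (@chernoff_type2_error _ _ _ _ hF _ _ _ hE _ mc s
      (fun n => mixed_bound a p (Mn n) (Kn n) s) _ HZ t alpha C alpha0 s0 hC Lfin)).
      by move=> n n0; exact: psi_ge0.
    by rewrite lee_fin ler_expR lerN2 lerB// sum_le.
  have mW : measurable [set w | (wealth E t w <= (alpha^-1)%:E)%E].
    exact: (measurable_wealth_le hF hE).
  have := chernoff; rewrite /type2_error.
  have Pfin := fin_num_measure P1 _ mW.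
  have Pge0 := fine_ge0 (measure_ge0 P1 [set w | (wealth E t w <= (alpha^-1)%:E)%E]).
  rewrite -(fineK Pfin); move: (fine _) Pge0 => r r0 h.
  (* Each admissible [s] bounds the exponent by [- ln r], hence so does the supremum. Taking this
     logarithm requires a positive error probability, so the value 0 is settled first. *)
  rewrite lee_fin; move: r0; rewrite le_eqVlt => /predU1P[<-|r0].
    exact: expR_ge0.
  rewrite -[leLHS]lnK ?posrE// ler_expR lerNr; apply: rate_le => // s sa.
  by rewrite lerNr -ler_expR lnK ?posrE// -lee_fin h.
- by move=> Kgt0 Dgt0; exact: rate_attained.
- by move=> Dgt0; exact: ratio_bounds.
Qed.
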